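(* Let $\mathcal{W}=\bigcup_{n=1}^N\mathcal{W}_n$ with $\mathcal{W}_n=\{\omega:|\omega-\overline{\omega}_n|\le W_n/2\}$ pairwise disjoint, and let $\alpha_0\ge 0$. Let $Q(z,\omega)$, with $Q(z,\cdot)\in L^2(\mathbb{R})$, be the Fourier transform of a bounded signal $q(z,t)$ propagating according to $$\frac{\partial}{\partial z}Q(z,\omega)=\left(-\frac{\alpha(\omega)}{2}+j\frac{\beta_2}{2}\omega^2\right)Q(z,\omega)+j\frac{\gamma}{4\pi^2}\int_{-\infty}^{\infty}\int_{-\infty}^{\infty}Q(z,\omega_1)Q^*(z,\omega_2)Q(z,\omega-\omega_1+\omega_2)\,d\omega_2\,d\omega_1$$ with the brick-walls attenuation profile $\alpha(\omega)=\alpha_0$ for $\omega\in\mathcal{W}$ and $\alpha(\omega)=\infty$ otherwise. Then the signal has no energy outside $\mathcal{W}$ for $z>0$: $$E_{\overline{\mathcal{W}}}(z)=0,\quad z>0,$$ where $\overline{\mathcal{W}}=\mathbb{R}\setminus\mathcal{W}$, and the signal energy satisfies $$E(z)=E_{\mathcal{W}}(0)e^{-\alpha_0 z}\quad (z>0).$$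
   Context: $z$ is distance, $\omega$ angular frequency, $t$ time; $Q(z,\omega)=\int q(z,t)e^{-j\omega t}dt$; $\beta_2,\gamma$ are real constants; ''bounded'' means $|q(z,t)|\le q_{\max}$ for some constant. For a set $\mathcal{S}\subseteq\mathbb{R}$, $E_{\mathcal{S}}(z)=\frac{1}{2\pi}\int_{\mathcal{S}}|Q(z,\omega)|^2d\omega$, and $E(z)=E_{\mathbb{R}}(z)$. The propagation with infinite attenuation outside $\mathcal{W}$ is understood as the limit $\alpha_1\to\infty$ of propagation with the finite profile $\alpha(\omega)=\alpha_0$ on $\mathcal{W}$ and $\alpha(\omega)=\alpha_1$ off $\mathcal{W}$. *)

(* Defs.v *)
From HB Require Import structures.
From mathcomp Require Import all_boot all_order all_algebra.
From mathcomp Require Import all_classical all_reals all_analysis.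
From mathcomp Require Export complex.
Import Order.TTheory GRing.Theory Num.Theory numFieldNormedType.Exports.
Set Implicit Arguments. Unset Strict Implicit. Unset Printing Implicit Defensive.
Local Open Scope classical_set_scope.
Local Open Scope ring_scope.
Local Open Scope complex_scope.

Section Defs.
Variable R : realType.
Local Notation mu := (@lebesgue_measure R).

Definition sqn (z : R[i]) : R := complex.Re z ^+ 2 + complex.Im z ^+ 2.
Definition cabs (z : R[i]) : R := Num.sqrt (sqn z).

Definition cintegrable (D : set R) (f : R -> R[i]) : Prop :=
  mu.-integrable D (fun x => (complex.Re (f x))%:E) /\
  mu.-integrable D (fun x => (complex.Im (f x))%:E).
Definition cint (D : set R) (f : R -> R[i]) : R[i] :=
  (Rintegral mu D (fun x => complex.Re (f x))) +i* (Rintegral mu D (fun x => complex.Im (f x))).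

Definition L2 (f : R -> R[i]) : Prop :=
  measurable_fun setT (fun x => complex.Re (f x)) /\
  measurable_fun setT (fun x => complex.Im (f x)) /\
  mu.-integrable setT (fun x => (sqn (f x))%:E).

Definition energy (Q : R -> R[i]) (S : set R) : \bar R :=
  ((2 * pi)^-1)%:E * (\int[mu]_(w in S) (sqn (Q w))%:E)%E.

Definition L2dist2 (f g : R -> R[i]) : \bar R :=
  (\int[mu]_(w in setT) (sqn (f w - g w))%:E)%E.

Definition cexpmi (x : R) : R[i] := (cos x) -i* (sin x).

Definition truncFT (q : R -> R[i]) (T : R) (w : R) : R[i] :=
  cint `[- T, T] (fun t => q t * cexpmi (w * t)).

(* Q is the (L^2, Plancherel) Fourier transform of q:
   Q(w) = int q(t) e^{-j w t} dt, understood as the L^2 limit of the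
   truncated transforms. *)
Definition is_FT (q Q : R -> R[i]) : Prop :=
  (forall T w, cintegrable `[- T, T] (fun t => q t * cexpmi (w * t))) /\
  (L2dist2 (truncFT q T) Q @[T --> +oo] --> 0%E).

Definition window (N : nat) (wbar Wd : 'I_N -> R) : set R :=
  \bigcup_(n in [set: 'I_N]) [set w | `|w - wbar n| <= Wd n / 2].

Definition brickwall (W : set R) (a0 a1 : R) (w : R) : R :=
  if `[< W w >] then a0 else a1.

Definition nlinner (Q : R -> R[i]) (w w1 : R) : R -> R[i] :=
  fun w2 => Q w1 * (Q w2)^* * Q (w - w1 + w2).
Definition nlterm (Q : R -> R[i]) (w : R) : R[i] :=
  cint setT (fun w1 => cint setT (nlinner Q w w1)).
Definition nl_defined (Q : R -> R[i]) (w : R) : Prop :=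
  (forall w1, cintegrable setT (nlinner Q w w1)) /\
  cintegrable setT (fun w1 => cint setT (nlinner Q w w1)).

Definition cderive (f : R -> R[i]) (z : R) (d : R[i]) : Prop :=
  is_derive z 1 (fun s => complex.Re (f s)) (complex.Re d) /\
  is_derive z 1 (fun s => complex.Im (f s)) (complex.Im d).

Definition nlse_rhs (alpha : R -> R) (b2 g : R) (Q : R -> R[i]) (w : R) : R[i] :=
  ((- alpha w / 2)%:C + 'i * (b2 / 2 * w ^+ 2)%:C) * Q w
  + 'i * (g / (4 * pi ^+ 2))%:C * nlterm Q w.

End Defs.

(* Main.v *)
(* The nonlinear term is the convolution of [Q] with the autocorrelation of [Q].
   Since [Q] is the transform of a signal bounded by [M], convolution with [Q]
   is bounded on L2 by a constant depending only on [M] (Bessel's inequality,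
   used twice), hence so is convolution with the autocorrelation; the latter is
   self-adjoint, so the nonlinear term conserves the energy.  The equation gives
   [d|Q|^2 = - alpha |Q|^2 + flux] pointwise, which may be integrated over a
   band as long as the energy stays bounded; it is locally bounded by a
   Baire-type argument, being finite, lower semicontinuous, and nonincreasing
   wherever it is bounded.  With out-of-band attenuation [a1] the out-of-band
   energy is then O(1/a1), so the energy exchanged with the band vanishes as
   [a1 -> +oo], which leaves only the decay [exp (- a0 z)] in the band. *)
Require Import Defs.
From HB Require Import structures.
From mathcomp Require Import all_boot all_order all_algebra.
From mathcomp Require Import all_classical all_reals all_analysis.
From mathcomp Require Import measurable_realfun complex lra ring.
Import Order.TTheory GRing.Theory Num.Theory numFieldNormedType.Exports.
Set Implicit Arguments.
Unset Strict Implicit.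
Unset Printing Implicit Defensive.
Local Open Scope classical_set_scope.
Local Open Scope ring_scope.
Local Open Scope complex_scope.

Local Notation Re := (@complex.Re _).
Local Notation Im := (@complex.Im _).
Local Notation "z ^*" := (conjc z) : ring_scope.
Arguments sqn {R} z.
Arguments cabs {R} z.

(** * Real-valued integrals *)

Section RealIntegral.
Context d {T : measurableType d} {R : realType}.
Variable mu : {measure set T -> \bar R}.
Implicit Types (D S : set T) (f g : T -> R).

Lemma measurable_int_EFin D f :
  mu.-integrable D (EFin \o f) -> measurable_fun D f.
Proof. by move=> /measurable_int/measurable_EFinP. Qed.

Lemma le_integrable_EFin D f g : measurable D -> measurable_fun D f ->
  mu.-integrable D (EFin \o g) -> (forall x, D x -> `|f x| <= g x) ->
  mu.-integrable D (EFin \o f).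
Proof.
move=> mD mf gi fg; apply: le_integrable gi => //; first exact/measurable_EFinP.
by move=> x Dx /=; rewrite lee_fin (le_trans (fg x Dx))// ler_norm.
Qed.

Lemma integrableD_EFin D f g : measurable D ->
  mu.-integrable D (EFin \o f) -> mu.-integrable D (EFin \o g) ->
  mu.-integrable D (EFin \o (fun x => f x + g x)).
Proof. by move=> mD fi gi; exact: (integrableD mD fi gi). Qed.

Lemma integrableB_EFin D f g : measurable D ->
  mu.-integrable D (EFin \o f) -> mu.-integrable D (EFin \o g) ->
  mu.-integrable D (EFin \o (fun x => f x - g x)).
Proof. by move=> mD fi gi; exact: (integrableB mD fi gi). Qed.

Lemma integrableZl_EFin D (k : R) f : measurable D ->
  mu.-integrable D (EFin \o f) ->
  mu.-integrable D (EFin \o (fun x => k * f x)).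
Proof. by move=> mD fi; exact: (integrableZl mD k fi). Qed.

Lemma EFin_Rintegral D f : measurable D -> mu.-integrable D (EFin \o f) ->
  (\int[mu]_(x in D) f x)%:E = (\int[mu]_(x in D) (f x)%:E)%E.
Proof.
by move=> mD fi; rewrite /Rintegral fineK//; exact: integrable_fin_num.
Qed.

Lemma ge0_subset_Rintegral S D f : measurable S -> measurable D ->
  S `<=` D -> (forall x, 0 <= f x) -> mu.-integrable D (EFin \o f) ->
  \int[mu]_(x in S) f x <= \int[mu]_(x in D) f x.
Proof.
move=> mS mD SD f0 fi; have fS : mu.-integrable S (EFin \o f).
  exact: integrableS fi.
rewrite -lee_fin !EFin_Rintegral//; apply: ge0_subset_integral => //.
- exact/measurable_EFinP/measurable_int_EFin.
- by move=> x _; rewrite lee_fin.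
Qed.

Lemma Rintegral_setC S f : measurable S -> mu.-integrable setT (EFin \o f) ->
  \int[mu]_x f x = \int[mu]_(x in S) f x + \int[mu]_(x in ~` S) f x.
Proof.
move=> mS fi; rewrite -Rintegral_setU ?setUv//; first exact: measurableC.
exact/disj_setPCl.
Qed.

Lemma dominated_cvg_Rintegral D (f_ : nat -> T -> R) f g : measurable D ->
  (forall n, measurable_fun D (f_ n)) ->
  (forall x, D x -> f_ n x @[n --> \oo] --> f x) ->
  mu.-integrable D (EFin \o g) ->
  (forall n x, D x -> `|f_ n x| <= g x) ->
  mu.-integrable D (EFin \o f) /\
  \int[mu]_(x in D) f_ n x @[n --> \oo] --> \int[mu]_(x in D) f x.
Proof.
move=> mD mf_ f_f gi f_g.
have mf : measurable_fun D f by apply: measurable_fun_cvg f_f.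
have mf_E n : measurable_fun D (EFin \o f_ n) by exact/measurable_EFinP.
have mfE : measurable_fun D (EFin \o f) by exact/measurable_EFinP.
have cvE : {ae mu, forall x, D x -> (f_ n x)%:E @[n --> \oo] --> (f x)%:E}.
  by apply: aeW => x Dx; apply: cvg_EFin; [exact: nearW|exact: f_f].
have leE : {ae mu, forall x n, D x -> (`|(f_ n x)%:E| <= (g x)%:E)%E}.
  by apply: aeW => x n Dx; rewrite lee_fin f_g.
have [fi _ cv] := dominated_convergence mD mf_E mfE cvE gi leE.
by split => //; apply: fine_cvg; rewrite EFin_Rintegral.
Qed.

Lemma fatou_Rintegral D (f_ : nat -> T -> R) f (C : R) : measurable D ->
  (forall n, mu.-integrable D (EFin \o f_ n)) ->
  (forall n x, 0 <= f_ n x) ->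
  (forall x, D x -> f_ n x @[n --> \oo] --> f x) ->
  (forall n, \int[mu]_(x in D) f_ n x <= C) ->
  mu.-integrable D (EFin \o f) /\ \int[mu]_(x in D) f x <= C.
Proof.
move=> mD f_i f_ge0 f_f f_C.
have mf_ n : measurable_fun D (f_ n) by exact: measurable_int_EFin (f_i n).
have mf : measurable_fun D f by apply: measurable_fun_cvg f_f.
have mf_E n : measurable_fun D (EFin \o f_ n) by exact/measurable_EFinP.
have f_E0 n x : D x -> (0 <= (EFin \o f_ n) x)%E by rewrite lee_fin f_ge0.
have f0 x : D x -> 0 <= f x.
  move=> Dx; rewrite -(cvg_lim _ (f_f x Dx))//; apply: limr_ge.
    by apply/cvg_ex; exists (f x); exact: f_f.
  exact: nearW.
have intf : (\int[mu]_(x in D) (f x)%:E <= C%:E)%E.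
  have := fatou mu mD mf_E f_E0; rewrite [X in (X <= _ -> _)%E](_ : _ =
      \int[mu]_(x in D) (f x)%:E)%E; last first.
    apply: eq_integral => x /[!inE] Dx; apply: (cvg_limn_einf_sup _).1.
    by apply: cvg_EFin; [exact: nearW|exact: f_f].
  move=> /le_trans; apply; rewrite limn_einf_lim.
  apply: lime_le; first exact: is_cvg_einfs.
  apply: nearW => n; apply: (@le_trans _ _ (\int[mu]_(x in D) (f_ n x)%:E)%E).
    by apply: ereal_inf_lbound; exists n => /=.
  by rewrite -EFin_Rintegral// lee_fin.
have fi : mu.-integrable D (EFin \o f).
  apply/integrableP; split; first exact/measurable_EFinP.
  rewrite (eq_integral (EFin \o f)) ?(le_lt_trans intf) ?ltry// => x /[!inE] Dx.
  by rewrite /= ger0_norm ?f0.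
by split => //; rewrite -lee_fin EFin_Rintegral.
Qed.

Lemma integrable_mul_sqr D f g : measurable D ->
  measurable_fun D f -> measurable_fun D g ->
  mu.-integrable D (EFin \o (fun x => f x ^+ 2)) ->
  mu.-integrable D (EFin \o (fun x => g x ^+ 2)) ->
  mu.-integrable D (EFin \o (fun x => f x * g x)).
Proof.
move=> mD mf mg fi gi.
apply: (@le_integrable_EFin _ _ (fun x => f x ^+ 2 + g x ^+ 2)) => //.
- exact: measurable_funM.
- exact: integrableD_EFin.
move=> x _; rewrite normrM -(real_normK (num_real (f x))).
rewrite -(real_normK (num_real (g x))).
by have := normr_ge0 (f x); have := normr_ge0 (g x); nra.
Qed.

Lemma cauchy_schwarz_Rintegral D f g : measurable D ->
  measurable_fun D f -> measurable_fun D g ->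
  mu.-integrable D (EFin \o (fun x => f x ^+ 2)) ->
  mu.-integrable D (EFin \o (fun x => g x ^+ 2)) ->
  (\int[mu]_(x in D) (f x * g x)) ^+ 2 <=
  (\int[mu]_(x in D) (f x ^+ 2)) * (\int[mu]_(x in D) (g x ^+ 2)).
Proof.
move=> mD mf mg fi gi; have fgi := integrable_mul_sqr mD mf mg fi gi.
set I := \int[mu]_(x in D) (f x * g x).
set F := \int[mu]_(x in D) (f x ^+ 2); set G := \int[mu]_(x in D) (g x ^+ 2).
have F0 : 0 <= F by apply: Rintegral_ge0 => x _; exact: sqr_ge0.
have G0 : 0 <= G by apply: Rintegral_ge0 => x _; exact: sqr_ge0.
have form_ge0 s t : 0 <= s ^+ 2 * F + 2 * s * t * I + t ^+ 2 * G.
  have : 0 <= \int[mu]_(x in D)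
      (s ^+ 2 * f x ^+ 2 + 2 * s * t * (f x * g x) + t ^+ 2 * g x ^+ 2).
    apply: Rintegral_ge0 => x _; rewrite [leRHS](_ : _ =
      (s * f x + t * g x) ^+ 2); last by ring.
    exact: sqr_ge0.
  by rewrite RintegralD ?RintegralD ?RintegralZl//;
    do ?[exact: integrableZl_EFin|apply: integrableD_EFin].
have [G00|Gn0] := eqVneq G 0.
  have [->|In0] := eqVneq I 0; first by rewrite G00; lra.
  have := form_ge0 1 (- (F + 1) / (2 * I)).
  rewrite G00 mulr0 addr0 expr1n mul1r mulr1.
  have -> : 2 * (- (F + 1) / (2 * I)) * I = - (F + 1) by field.
  by lra.
have Gp : 0 < G by rewrite lt_neqAle eq_sym Gn0.
by have := form_ge0 G (- I); nra.
Qed.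

End RealIntegral.

Section RealFubini.
Context d1 d2 {T1 : measurableType d1} {T2 : measurableType d2} {R : realType}.
Variables (m1 : {sigma_finite_measure set T1 -> \bar R})
  (m2 : {sigma_finite_measure set T2 -> \bar R}).

Lemma measurable_Rintegral_param (F : T1 * T2 -> R) : measurable_fun setT F ->
  measurable_fun setT (fun x => \int[m2]_y F (x, y)).
Proof.
move=> /measurable_EFinP mF; rewrite /Rintegral.
apply: (@measurableT_comp _ _ _ _ _ _ (@fine R) _
  (fun x => \int[m2]_y (F (x, y))%:E)%E) => //.
under eq_fun => x do rewrite integralE.
apply: emeasurable_funB.
- rewrite [X in measurable_fun _ X](_ : _ = fubini_F m2 ((EFin \o F)^\+)%E).
    by apply: measurable_fun_fubini_tonelli_F => //; exact: measurable_funepos.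
  by apply/funext => x; apply: eq_integral => y _; rewrite !funeposE.
- rewrite [X in measurable_fun _ X](_ : _ = fubini_F m2 ((EFin \o F)^\-)%E).
    by apply: measurable_fun_fubini_tonelli_F => //; exact: measurable_funeneg.
  by apply/funext => x; apply: eq_integral => y _; rewrite !funenegE.
Qed.

Lemma Rintegral_fubini (F : T1 * T2 -> R) :
  (m1 \x m2)%E.-integrable setT (EFin \o F) ->
  \int[m1]_x \int[m2]_y F (x, y) = \int[m2]_y \int[m1]_x F (x, y).
Proof.
move=> Fi; have finK d (T : measurableType d)
    (m : {measure set T -> \bar R}) (f : T -> \bar R) :
    m.-integrable setT f -> (\int[m]_x (fine (f x))%:E = \int[m]_x f x)%E.
  move=> fi; have mf := measurable_int _ fi.
  apply: ae_eq_integral => //.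
    by apply/measurable_EFinP; exact: measurableT_comp.
  apply: filterS (integrable_ae measurableT fi) => x fin _.
  by rewrite fineK// fin.
have Gi : m2.-integrable setT (fubini_G m1 (EFin \o F)).
  apply/integrableP; split; first exact: (measurable_fubini_G Fi).
  have := (integrable21ltyP m1 m2 (measurable_int _ Fi)).1 Fi.
  apply: le_lt_trans.
  apply: ge0_le_integral => //.
  - by apply: measurableT_comp => //; exact: (measurable_fubini_G Fi).
  - apply: (measurable_fun_fubini_tonelli_G (fun z => `|(F z)%:E|%E)) => //.
    by apply: measurableT_comp => //; exact: measurable_int Fi.
  move=> y _; apply: le_abse_integral => //.
  by apply: measurableT_comp; first exact: measurable_int Fi.
transitivity (fine (\int[m1]_x \int[m2]_y (F (x, y))%:E)%E).
  exact: (congr1 fine (finK _ _ _ _ (integrable_fubini_F Fi))).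
by rewrite (Fubini Fi); exact: (congr1 fine (esym (finK _ _ _ _ Gi))).
Qed.

Lemma integrable_kernel (f : T1 -> R) (k : T1 * T2 -> R) (B : R) :
  m1.-integrable setT (EFin \o f) -> measurable_fun setT k ->
  (forall x, m2.-integrable setT (fun y => (k (x, y))%:E)) ->
  (forall x, \int[m2]_y `|k (x, y)| <= B) ->
  (m1 \x m2)%E.-integrable setT (EFin \o (fun z => f z.1 * k z)).
Proof.
move=> fi mk ki kB; have mf := measurable_int_EFin fi.
have mF : measurable_fun setT (fun z : T1 * T2 => f z.1 * k z).
  by apply: measurable_funM => //; exact: measurableT_comp mf _.
apply/integrable12ltyP; first exact/measurable_EFinP.
have fB := integrableZl_EFin B measurableT (integrable_norm fi).
have /integrableP[_] := fB; apply: le_lt_trans; apply: ge0_le_integral => //.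
- by move=> x _; exact: integral_ge0.
- apply: (measurable_fun_fubini_tonelli_F
    (fun z => (`|(f z.1 * k z)%:E|)%E)) => //.
  by apply: measurableT_comp => //; exact/measurable_EFinP.
- by apply: measurableT_comp => //; exact: measurable_int fB.
move=> x _ /=; under eq_integral do rewrite normrM EFinM.
rewrite ge0_integralZl_EFin//; last first.
  exact: measurable_int (integrable_norm (ki x)).
rewrite -EFin_Rintegral//; last exact: integrable_norm (ki x).
by rewrite -EFinM lee_fin (le_trans _ (ler_norm _))// mulrC ler_wpM2r.
Qed.

End RealFubini.

(** * Complex-valued integrals *)

Lemma young_sqr (R : realFieldType) (e x y : R) : 0 < e ->
  2 * (x * y) <= e * x ^+ 2 + e^-1 * y ^+ 2.
Proof.
move=> e0; rewrite -subr_ge0 (_ : _ - _ = e^-1 * (e * x - y) ^+ 2).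
  by rewrite mulr_ge0 ?sqr_ge0// invr_ge0 ltW.
by field; rewrite gt_eqF.
Qed.

Section ComplexModulus.
Context {R : realType}.
Implicit Types (a b z : R[i]) (x y : R).

Lemma complex_ext a b : Re a = Re b -> Im a = Im b -> a = b.
Proof. by case: a => ? ?; case: b => ? ? /= -> ->. Qed.

Lemma Re_mulc a b : Re (a * b) = Re a * Re b - Im a * Im b.
Proof. by case: a => ? ?; case: b. Qed.

Lemma Im_mulc a b : Im (a * b) = Re a * Im b + Im a * Re b.
Proof. by case: a => ? ?; case: b. Qed.

Lemma Re_subc a b : Re (a - b) = Re a - Re b.
Proof. by case: a => ? ?; case: b. Qed.

Lemma Im_subc a b : Im (a - b) = Im a - Im b.
Proof. by case: a => ? ?; case: b. Qed.

Lemma Re_conjc z : Re z^* = Re z. Proof. by case: z. Qed.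

Lemma Im_conjc z : Im z^* = - Im z. Proof. by case: z. Qed.

Lemma conjcM a b : (a * b)^* = a^* * b^*. Proof. exact: rmorphM. Qed.

Lemma sqn_ge0 z : 0 <= sqn z.
Proof. by rewrite /sqn addr_ge0 ?sqr_ge0. Qed.

Lemma sqn_eq0 z : sqn z = 0 -> z = 0.
Proof.
move=> /eqP; rewrite /sqn paddr_eq0 ?sqr_ge0// !sqrf_eq0.
move=> /andP[/eqP ? /eqP ?].
exact: complex_ext.
Qed.

Lemma sqnM a b : sqn (a * b) = sqn a * sqn b.
Proof. by rewrite /sqn Re_mulc Im_mulc; ring. Qed.

Lemma sqnJ z : sqn z^* = sqn z.
Proof. by rewrite /sqn Re_conjc Im_conjc sqrrN. Qed.

Lemma sqnC a b : sqn (a - b) = sqn (b - a).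
Proof. by rewrite /sqn !Re_subc !Im_subc; ring. Qed.

Lemma sqnB_le a b : sqn (a - b) <= 2 * (sqn a + sqn b).
Proof.
rewrite /sqn Re_subc Im_subc.
by have := sqr_ge0 (Re a + Re b); have := sqr_ge0 (Im a + Im b); nra.
Qed.

Lemma mulcJ_sqn z : z * z^* = (sqn z)%:C.
Proof. by case: z => x y; apply: complex_ext; rewrite /sqn /=; ring. Qed.

Lemma cabs_ge0 z : 0 <= cabs z. Proof. exact: sqrtr_ge0. Qed.

Lemma normr_cabs z : `|cabs z| = cabs z.
Proof. exact/ger0_norm/cabs_ge0. Qed.

Lemma sqr_cabs z : cabs z ^+ 2 = sqn z.
Proof. exact/sqr_sqrtr/sqn_ge0. Qed.

Lemma cabsM a b : cabs (a * b) = cabs a * cabs b.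
Proof. by rewrite /cabs sqnM sqrtrM ?sqn_ge0. Qed.

Lemma cabsJ z : cabs z^* = cabs z.
Proof. by rewrite /cabs sqnJ. Qed.

Lemma cabs_real x : cabs x%:C = `|x|.
Proof. by rewrite /cabs /sqn/= expr0n addr0 sqrtr_sqr. Qed.

Lemma cabs_le_sqn z x : 0 <= x -> (cabs z <= x) = (sqn z <= x ^+ 2).
Proof. by move=> x0; rewrite -sqr_cabs ler_sqr ?nnegrE ?cabs_ge0. Qed.

Lemma normr_Re_le z : `|Re z| <= cabs z.
Proof. by rewrite -sqrtr_sqr ler_sqrt ?sqn_ge0// lerDl sqr_ge0. Qed.

Lemma normr_Im_le z : `|Im z| <= cabs z.
Proof. by rewrite -sqrtr_sqr ler_sqrt ?sqn_ge0// lerDr sqr_ge0. Qed.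

Lemma cabs_le_ReIm z : cabs z <= `|Re z| + `|Im z|.
Proof.
rewrite cabs_le_sqn ?addr_ge0// /sqn -(real_normK (num_real (Re z))).
rewrite -(real_normK (num_real (Im z))) sqrrD lerD2r lerDl.
by rewrite mulrn_wge0 ?mulr_ge0.
Qed.

(* Young's inequality applied to
   [sqn a - sqn b = sqn (a - b) + 2 Re ((a - b) b^* )]. *)
Lemma sqn_dist_le (e : R) a b : 0 < e ->
  `|sqn a - sqn b| <= e * sqn b + (1 + e^-1) * sqn (a - b).
Proof.
move=> e0; have young_norm x y : `|2 * (x * y)| <= e * y ^+ 2 + e^-1 * x ^+ 2.
  rewrite ler_norml lerNl -mulrN -mulrN -{1}(sqrrN x).
  by rewrite [x * - y]mulrN -mulNr !(mulrC _ y) !young_sqr.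
have -> : sqn a - sqn b = sqn (a - b) +
    (2 * (Re (a - b) * Re b) + 2 * (Im (a - b) * Im b)).
  by rewrite /sqn !Re_subc !Im_subc; ring.
apply: (le_trans (ler_normD _ _)); rewrite ger0_norm ?sqn_ge0//.
rewrite [(1 + _) * _]mulrDl mul1r addrCA lerD2l (le_trans (ler_normD _ _))//.
apply: (le_trans (lerD (young_norm _ _) (young_norm _ _))).
by rewrite le_eqVlt /sqn; apply/orP; left; apply/eqP; ring.
Qed.

Lemma cexpmiD x y : cexpmi (x + y) = cexpmi x * cexpmi y.
Proof.
by apply: complex_ext; rewrite ?Re_mulc ?Im_mulc /= ?cosD ?sinD; ring.
Qed.

Lemma cexpmi0 : cexpmi (0 : R) = 1.
Proof. by rewrite /cexpmi cos0 sin0 oppr0. Qed.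

Lemma conjc_cexpmi x : (cexpmi x)^* = cexpmi (- x).
Proof. by rewrite /cexpmi /= cosN sinN opprK. Qed.

Lemma cabs_cexpmi x : cabs (cexpmi x) = 1.
Proof. by rewrite /cabs /sqn/= sqrrN cos2Dsin2 sqrtr1. Qed.

End ComplexModulus.

Section ComplexMeasurable.
Context d {T : measurableType d} {R : realType}.
Implicit Types (D : set T) (f g : T -> R[i]) (u : T -> R).

Definition cmeasurable D f :=
  measurable_fun D (Re \o f) /\ measurable_fun D (Im \o f).

Lemma cmeasurableB D f g : cmeasurable D f -> cmeasurable D g ->
  cmeasurable D (fun x => f x - g x).
Proof.
move=> [mf1 mf2] [mg1 mg2]; split.
- rewrite (_ : _ \o _ = fun x => Re (f x) - Re (g x)).
    exact: measurable_funB.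
  by apply/funext => x /=; rewrite Re_subc.
- rewrite (_ : _ \o _ = fun x => Im (f x) - Im (g x)).
    exact: measurable_funB.
  by apply/funext => x /=; rewrite Im_subc.
Qed.

Lemma cmeasurableM D f g : cmeasurable D f -> cmeasurable D g ->
  cmeasurable D (fun x => f x * g x).
Proof.
move=> [mf1 mf2] [mg1 mg2]; split.
- rewrite (_ : _ \o _ = fun x => Re (f x) * Re (g x) - Im (f x) * Im (g x)).
    by apply: measurable_funB; exact: measurable_funM.
  by apply/funext => x /=; rewrite Re_mulc.
- rewrite (_ : _ \o _ = fun x => Re (f x) * Im (g x) + Im (f x) * Re (g x)).
    by apply: measurable_funD; exact: measurable_funM.
  by apply/funext => x /=; rewrite Im_mulc.
Qed.

Lemma cmeasurableJ D f : cmeasurable D f -> cmeasurable D (fun x => (f x)^*).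
Proof.
move=> [mf1 mf2]; split.
- by rewrite (_ : _ \o _ = Re \o f)//; apply/funext => x /=; rewrite Re_conjc.
- rewrite (_ : _ \o _ = fun x => - Im (f x)); first exact: measurable_funN.
  by apply/funext => x /=; rewrite Im_conjc.
Qed.

Lemma cmeasurable_real D u : measurable_fun D u ->
  cmeasurable D (fun x => (u x)%:C).
Proof. by move=> mu; split=> //; exact: measurable_cst. Qed.

Lemma cmeasurable_cexpmi D u : measurable_fun D u ->
  cmeasurable D (fun x => cexpmi (u x)).
Proof.
move=> mu; split.
  exact: measurableT_comp (continuous_measurable_fun (@continuous_cos R)) mu.
by apply: measurable_funN;
  exact: measurableT_comp (continuous_measurable_fun (@continuous_sin R)) mu.
Qed.

Lemma measurable_sqn D f : cmeasurable D f -> measurable_fun D (sqn \o f).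
Proof. by move=> [mf1 mf2]; apply: measurable_funD; exact: measurable_funX. Qed.

Lemma measurable_cabs D f : cmeasurable D f -> measurable_fun D (cabs \o f).
Proof.
move=> /measurable_sqn; apply: measurableT_comp.
by apply: continuous_measurable_fun; exact: sqrt_continuous.
Qed.

End ComplexMeasurable.

Lemma cmeasurable_comp d d' (T : measurableType d) (T' : measurableType d')
    (R : realType) (D : set T) (f : T' -> R[i]) (u : T -> T') :
  cmeasurable setT f -> measurable_fun D u -> cmeasurable D (f \o u).
Proof.
by move=> [mf1 mf2] mu; split; [exact: measurableT_comp mf1 mu|
  exact: measurableT_comp mf2 mu].
Qed.

Section ComplexIntegral.
Context {R : realType}.
Notation mu := (@lebesgue_measure R).
Implicit Types (D : set (measurableTypeR R)) (f g : R -> R[i]).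

Lemma cintegrableP D f : measurable D -> cintegrable D f <->
  cmeasurable D f /\ mu.-integrable D (EFin \o (cabs \o f)).
Proof.
move=> mD; split=> [[rei imi]|[mf fi]].
- have mf : cmeasurable D f.
    by split; [exact: measurable_int_EFin rei|exact: measurable_int_EFin imi].
  split=> //; apply: (le_integrable_EFin _ (measurable_cabs mf)
    (integrableD_EFin mD (integrable_norm rei) (integrable_norm imi))) => //.
  by move=> x _; rewrite normr_cabs cabs_le_ReIm.
- split; apply: (le_integrable_EFin _ _ fi) => //; try exact: mf.1;
    try exact: mf.2; move=> x _; [exact: normr_Re_le|exact: normr_Im_le].
Qed.

Lemma cintegrable_cmeasurable D f : measurable D ->
  cintegrable D f -> cmeasurable D f.
Proof. by move=> mD /(cintegrableP _ mD)[]. Qed.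

Lemma cintegrable_cabs D f : measurable D ->
  cintegrable D f -> mu.-integrable D (EFin \o (cabs \o f)).
Proof. by move=> mD /(cintegrableP _ mD)[]. Qed.

Lemma le_cintegrable D f (g : R -> R) : measurable D -> cmeasurable D f ->
  mu.-integrable D (EFin \o g) -> (forall x, D x -> cabs (f x) <= g x) ->
  cintegrable D f.
Proof.
move=> mD mf gi fg; apply/cintegrableP => //; split=> //.
apply: le_integrable_EFin gi _ => //; first exact: measurable_cabs.
by move=> x Dx; rewrite normr_cabs fg.
Qed.

Lemma cintegrable_real D (u : R -> R) : measurable D ->
  mu.-integrable D (EFin \o u) -> cintegrable D (fun x => (u x)%:C).
Proof. by move=> mD ui; split => //=; exact: integrable0. Qed.

Lemma cintegrableM_bounded D f g (B : R) : measurable D ->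
  cintegrable D f -> cmeasurable D g -> (forall x, cabs (g x) <= B) ->
  cintegrable D (fun x => f x * g x).
Proof.
move=> mD fi mg gB; have [mf fi'] := (cintegrableP _ mD).1 fi.
have fBi := integrableZl_EFin B mD fi'.
apply: (le_cintegrable _ (cmeasurableM mf mg) fBi) => //.
by move=> x _; rewrite cabsM mulrC ler_wpM2r ?cabs_ge0.
Qed.

Lemma cintegrableZl D (c : R[i]) f : measurable D ->
  cintegrable D f -> cintegrable D (fun x => c * f x).
Proof.
move=> mD fi; under eq_fun do rewrite mulrC.
apply: (cintegrableM_bounded (B := cabs c)) => //.
by split; exact: measurable_cst.
Qed.

Lemma cintegrableJ D f : measurable D ->
  cintegrable D f -> cintegrable D (fun x => (f x)^*).
Proof.
move=> mD /(cintegrableP _ mD)[mf fi]; apply/cintegrableP => //.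
split; first exact: cmeasurableJ.
by rewrite (_ : _ \o _ = cabs \o f)//; apply/funext => x /=; rewrite cabsJ.
Qed.

Lemma eq_cint D f g : (forall x, D x -> f x = g x) -> cint D f = cint D g.
Proof.
move=> fg; apply: complex_ext; apply: eq_Rintegral => x /set_mem Dx;
  by rewrite fg.
Qed.

Lemma cintB D f g : measurable D -> cintegrable D f -> cintegrable D g ->
  cint D (fun x => f x - g x) = cint D f - cint D g.
Proof.
move=> mD [f1 f2] [g1 g2]; apply: complex_ext;
  rewrite ?Re_subc ?Im_subc -RintegralB//=.
- by apply: eq_Rintegral => x _; rewrite Re_subc.
- by apply: eq_Rintegral => x _; rewrite Im_subc.
Qed.

Lemma cintZl D (c : R[i]) f : measurable D -> cintegrable D f ->
  cint D (fun x => c * f x) = c * cint D f.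
Proof.
move=> mD [f1 f2]; apply: complex_ext.
- rewrite Re_mulc -!RintegralZl// -RintegralB//; try exact: integrableZl_EFin.
  by apply: eq_Rintegral => x _; rewrite Re_mulc.
- rewrite Im_mulc -!RintegralZl// -RintegralD//; try exact: integrableZl_EFin.
  by apply: eq_Rintegral => x _; rewrite Im_mulc.
Qed.

Lemma cintJ D f : measurable D -> cintegrable D f ->
  cint D (fun x => (f x)^*) = (cint D f)^*.
Proof.
move=> mD [f1 f2]; apply: complex_ext.
- by rewrite Re_conjc; apply: eq_Rintegral => x _; rewrite Re_conjc.
- rewrite Im_conjc -mulN1r -RintegralZl//.
  by apply: eq_Rintegral => x _; rewrite Im_conjc mulN1r.
Qed.

Lemma cint_real D (u : R -> R) :
  cint D (fun x => (u x)%:C) = (\int[mu]_(x in D) u x)%:C.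
Proof. by rewrite /cint/= /Rintegral integral0. Qed.

Lemma cabs_cint_le D f : measurable D -> cintegrable D f ->
  cabs (cint D f) <= \int[mu]_(x in D) cabs (f x).
Proof.
move=> mD fi; have fi' := cintegrable_cabs mD fi; set I := cint D f.
have cabs_ReI : cabs I ^+ 2 = \int[mu]_(x in D) Re (I^* * f x).
  transitivity (Re (I^* * I)); first by rewrite mulrC mulcJ_sqn sqr_cabs.
  by rewrite /I -cintZl.
have [->|I0] := eqVneq (cabs I) 0.
  by apply: Rintegral_ge0 => x _; exact: cabs_ge0.
rewrite -(@ler_pM2l _ (cabs I)) ?lt_neqAle ?(eq_sym 0) ?I0 ?cabs_ge0//.
rewrite -expr2 cabs_ReI -RintegralZl//; apply: le_Rintegral => //.
- exact: (cintegrableZl _ mD fi).1.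
- exact: integrableZl_EFin.
move=> x _; rewrite (le_trans (ler_norm _))// (le_trans (normr_Re_le _))//.
by rewrite cabsM cabsJ.
Qed.

Lemma cabs_cintM_bounded_le D f g (B : R) : measurable D ->
  cintegrable D f -> cmeasurable D g -> (forall x, cabs (g x) <= B) ->
  cabs (cint D (fun x => f x * g x)) <= B * \int[mu]_(x in D) cabs (f x).
Proof.
move=> mD fi mg gB; have fgi := cintegrableM_bounded mD fi mg gB.
have fi' := cintegrable_cabs mD fi.
apply: (le_trans (cabs_cint_le mD fgi)); rewrite -RintegralZl//.
apply: le_Rintegral => //; [exact: cintegrable_cabs|exact: integrableZl_EFin|].
by move=> x _; rewrite cabsM mulrC ler_wpM2r ?cabs_ge0.
Qed.

Lemma cmeasurable_cint_param (F : R * R -> R[i]) : cmeasurable setT F ->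
  cmeasurable setT (fun x => cint setT (fun y => F (x, y))).
Proof.
move=> [mF1 mF2]; split.
  exact: (measurable_Rintegral_param mu mF1).
exact: (measurable_Rintegral_param mu mF2).
Qed.

Lemma cint_kernel_swap f (K : R * R -> R[i]) (B : R) :
  cintegrable setT f -> cmeasurable setT K ->
  (forall x, cintegrable setT (fun y => K (x, y))) ->
  (forall x, \int[mu]_y cabs (K (x, y)) <= B) ->
  cint setT (fun x => f x * cint setT (fun y => K (x, y))) =
  cint setT (fun y => cint setT (fun x => f x * K (x, y))).
Proof.
move=> fi mK Ki KB; have mf := cintegrable_cmeasurable measurableT fi.
pose F (z : R * R) := f z.1 * K z.
have mF : cmeasurable setT F.
  by apply: cmeasurableM => //; exact: cmeasurable_comp mf _.
have absFi : (mu \x mu)%E.-integrable setT (EFin \o (cabs \o F)).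
  rewrite (_ : cabs \o F = fun z => cabs (f z.1) * cabs (K z)).
    apply: (@integrable_kernel _ _ (measurableTypeR R) (measurableTypeR R) R
      mu mu (cabs \o f) (cabs \o K) B).
    - exact: cintegrable_cabs.
    - exact: measurable_cabs.
    - by move=> x; exact: cintegrable_cabs (Ki x).
    - move=> x; under eq_Rintegral do rewrite normr_cabs.
      exact: KB.
  by apply/funext => z; rewrite /= cabsM.
transitivity (cint setT (fun x => cint setT (fun y => F (x, y)))).
  by apply: eq_cint => x _; rewrite -cintZl//; exact: Ki.
have swap (P : R[i] -> R) : measurable_fun setT (P \o F) ->
    (forall z, `|P z| <= cabs z) ->
    \int[mu]_x \int[mu]_y P (F (x, y)) = \int[mu]_y \int[mu]_x P (F (x, y)).
  move=> mP Ple; apply: (@Rintegral_fubini _ _ (measurableTypeR R)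
    (measurableTypeR R) R mu mu (P \o F)).
  by apply: le_integrable_EFin absFi _ => // z _; exact: Ple.
apply: complex_ext; [exact: (swap Re mF.1 normr_Re_le)|].
exact: (swap Im mF.2 normr_Im_le).
Qed.

End ComplexIntegral.

Section Reflection.
Context {R : realType}.
Notation mu := (@lebesgue_measure R).
Implicit Types (a : R) (f : R -> R).

Let reflect a : measurableTypeR R -> measurableTypeR R := fun x => a - x.

Let measurable_reflect a : measurable_fun setT (reflect a).
Proof. exact: measurable_funB. Qed.

Lemma lebesgue_measure_reflect a (A : set (measurableTypeR R)) : measurable A ->
  pushforward mu (reflect a) A = mu A.
Proof.
move=> mA; apply/esym/lebesgue_measure_unique => //= _ [[b c] _ <-].
rewrite /pushforward (_ : _ @^-1` _ = `[a - c, a - b[%classic); last first.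
  by apply/seteqP; split=> x /=; rewrite /reflect !in_itv/= => /andP[? ?];
    apply/andP; split; lra.
rewrite !lebesgue_measure_itv/= !lte_fin ltrD2l ltrN2; case: ifPn => // _.
by rewrite -!EFinB; congr (_%:E); ring.
Qed.

Lemma integrable_reflect a f : mu.-integrable setT (EFin \o f) ->
  mu.-integrable setT (EFin \o (fun x => f (a - x))).
Proof.
move=> /integrableP[mf fi]; apply/integrableP; split.
  exact: (measurableT_comp mf (measurable_reflect a)).
move: fi.
rewrite (eq_measure_integral (pushforward mu (reflect a))); last first.
  by move=> A mA _; exact/esym/lebesgue_measure_reflect.
rewrite (ge0_integral_pushforward (measurable_reflect a))//.
exact: measurableT_comp.
Qed.

Lemma Rintegral_reflect a f : mu.-integrable setT (EFin \o f) ->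
  \int[mu]_x f (a - x) = \int[mu]_x f x.
Proof.
move=> fi; apply/esym; rewrite /Rintegral.
rewrite (eq_measure_integral (pushforward mu (reflect a))); last first.
  by move=> A mA _; exact/esym/lebesgue_measure_reflect.
rewrite (integral_pushforward (measurable_reflect a))//.
  exact: (measurable_int _ fi).
exact: integrable_reflect.
Qed.

End Reflection.

Section ComplexReflection.
Context {R : realType}.
Implicit Types (a : R) (f : R -> R[i]).

Lemma cintegrable_reflect a f :
  cintegrable setT f -> cintegrable setT (fun x => f (a - x)).
Proof.
move=> [rei imi]; split.
- exact: (integrable_reflect a rei).
- exact: (integrable_reflect a imi).
Qed.

Lemma cint_reflect a f : cintegrable setT f ->
  cint setT (fun x => f (a - x)) = cint setT f.
Proof.
move=> [rei imi]; apply: complex_ext.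
- exact: (Rintegral_reflect a rei).
- exact: (Rintegral_reflect a imi).
Qed.

Lemma cintegrable_shift a f :
  cintegrable setT f -> cintegrable setT (fun x => f (x - a)).
Proof.
move=> /(cintegrable_reflect 0)/(cintegrable_reflect a).
by under eq_fun do rewrite sub0r opprB.
Qed.

Lemma cint_shift a f : cintegrable setT f ->
  cint setT (fun x => f (x - a)) = cint setT f.
Proof.
move=> fi; rewrite -(cint_reflect 0 fi).
rewrite -(cint_reflect a (cintegrable_reflect 0 fi)).
by apply: eq_cint => x _; rewrite sub0r opprB.
Qed.

End ComplexReflection.

(** * Convolution on L2 *)

Section SquareIntegrable.
Context {R : realType}.
Notation mu := (@lebesgue_measure R).
Implicit Types (S : set (measurableTypeR R)) (f g h : R -> R[i]).

Definition sqnorm_on S f : R := \int[mu]_(x in S) sqn (f x).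

Local Notation sqnorm := (sqnorm_on setT).

Lemma L2P f : L2 f <->
  cmeasurable setT f /\ mu.-integrable setT (EFin \o (sqn \o f)).
Proof. by split=> [[? [? ?]]|[[? ?] ?]]. Qed.

Lemma L2_cmeasurable f : L2 f -> cmeasurable setT f.
Proof. by move=> /L2P[]. Qed.

Lemma L2_integrable S f : measurable S -> L2 f ->
  mu.-integrable S (EFin \o (sqn \o f)).
Proof. by move=> mS /L2P[_]; exact: integrableS. Qed.

Lemma sqnorm_on_ge0 S f : 0 <= sqnorm_on S f.
Proof. by apply: Rintegral_ge0 => x _; exact: sqn_ge0. Qed.

Lemma sqnorm_on_le S f : measurable S -> L2 f -> sqnorm_on S f <= sqnorm f.
Proof.
move=> mS Lf; apply: ge0_subset_Rintegral => //; last exact: L2_integrable.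
by move=> x; exact: sqn_ge0.
Qed.

Lemma sqnorm_setC S f : measurable S -> L2 f ->
  sqnorm f = sqnorm_on S f + sqnorm_on (~` S) f.
Proof. by move=> mS Lf; apply: Rintegral_setC => //; exact: L2_integrable. Qed.

Lemma L2_le (k : R) f g : cmeasurable setT f -> L2 g ->
  (forall x, sqn (f x) <= k * sqn (g x)) -> L2 f /\ sqnorm f <= k * sqnorm g.
Proof.
move=> mf Lg fg; have gi := L2_integrable measurableT Lg.
have kgi := integrableZl_EFin k measurableT gi.
have Lf : L2 f.
  apply/L2P; split=> //; apply: le_integrable_EFin kgi _ => //.
    exact: measurable_sqn mf.
  by move=> x _; rewrite /= ger0_norm ?sqn_ge0.
split=> //; rewrite /sqnorm_on -RintegralZl//; apply: le_Rintegral => //.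
exact: L2_integrable.
Qed.

Lemma L2B f g : L2 f -> L2 g -> L2 (fun x => f x - g x).
Proof.
move=> Lf Lg; have mfg := cmeasurableB (L2_cmeasurable Lf) (L2_cmeasurable Lg).
have fgi := integrableZl_EFin 2 measurableT (integrableD_EFin measurableT
  (L2_integrable measurableT Lf) (L2_integrable measurableT Lg)).
apply/L2P; split=> //; apply: le_integrable_EFin fgi _ => //.
  exact: measurable_sqn mfg.
by move=> x _; rewrite /= ger0_norm ?sqn_ge0 ?sqnB_le.
Qed.

Lemma L2_reflect (a : R) f : L2 f -> L2 (fun x => f (a - x)).
Proof.
move=> /L2P[mf fi]; apply/L2P; split; last exact: (integrable_reflect a fi).
exact: (cmeasurable_comp mf (measurable_funB _ _)).
Qed.

Lemma sqnorm_reflect (a : R) f : L2 f -> sqnorm (fun x => f (a - x)) = sqnorm f.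
Proof. by move=> /L2P[_ fi]; exact: (Rintegral_reflect a fi). Qed.

Lemma L2_shift (a : R) f : L2 f -> L2 (fun x => f (x - a)).
Proof.
move=> /(L2_reflect 0)/(L2_reflect a).
by under eq_fun do rewrite sub0r opprB.
Qed.

Lemma sqnorm_shift (a : R) f : L2 f -> sqnorm (fun x => f (x - a)) = sqnorm f.
Proof.
move=> Lf; rewrite -(sqnorm_reflect 0 Lf) -(sqnorm_reflect a (L2_reflect 0 Lf)).
by apply: eq_Rintegral => x _; rewrite sub0r opprB.
Qed.

Lemma L2J f : L2 f -> L2 (fun x => (f x)^*).
Proof.
move=> /L2P[mf fi]; apply/L2P; split; first exact: cmeasurableJ.
by rewrite (_ : _ \o _ = sqn \o f)//; apply/funext => x /=; rewrite sqnJ.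
Qed.

Lemma sqnormJ f : sqnorm (fun x => (f x)^*) = sqnorm f.
Proof. by apply: eq_Rintegral => x _; rewrite sqnJ. Qed.

Let mul_cabs_le (a b : R[i]) : cabs a * cabs b <= sqn a + sqn b.
Proof.
by rewrite -!sqr_cabs; have := cabs_ge0 a; have := cabs_ge0 b; nra.
Qed.

Lemma cintegrable_mul f g : L2 f -> L2 g ->
  cintegrable setT (fun x => f x * g x).
Proof.
move=> Lf Lg.
have fg_int := integrableD_EFin measurableT
  (L2_integrable measurableT Lf) (L2_integrable measurableT Lg).
have mfg := cmeasurableM (L2_cmeasurable Lf) (L2_cmeasurable Lg).
apply: (le_cintegrable _ mfg fg_int) => //.
by move=> x _; rewrite cabsM mul_cabs_le.
Qed.

Lemma Rintegral_cabs_mul_le f g : L2 f -> L2 g ->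
  \int[mu]_x cabs (f x * g x) <= sqnorm f + sqnorm g.
Proof.
move=> Lf Lg; have fi := L2_integrable measurableT Lf.
have gi := L2_integrable measurableT Lg.
rewrite /sqnorm_on -RintegralD//; apply: le_Rintegral => //.
- exact: cintegrable_cabs (cintegrable_mul Lf Lg).
- exact: integrableD_EFin.
- by move=> x _; rewrite cabsM mul_cabs_le.
Qed.

Lemma sqn_cint_mul_le f g : L2 f -> L2 g ->
  sqn (cint setT (fun x => f x * g x)) <= sqnorm f * sqnorm g.
Proof.
move=> Lf Lg; have fgi := cintegrable_mul Lf Lg.
have mcabs h : L2 h -> measurable_fun setT (cabs \o h).
  by move=> /L2_cmeasurable; exact: measurable_cabs.
have cabs2i h : L2 h ->
    mu.-integrable setT (EFin \o (fun x => (cabs \o h) x ^+ 2)).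
  by move=> Lh; under eq_fun do rewrite /= sqr_cabs; exact: L2_integrable.
have sqnormE h : sqnorm h = \int[mu]_x ((cabs \o h) x ^+ 2).
  by apply: eq_Rintegral => x _; rewrite /= sqr_cabs.
rewrite -sqr_cabs !sqnormE.
have cs : (\int[mu]_x ((cabs \o f) x * (cabs \o g) x)) ^+ 2 <=
    \int[mu]_x ((cabs \o f) x ^+ 2) * \int[mu]_x ((cabs \o g) x ^+ 2).
  by apply: cauchy_schwarz_Rintegral => //; do ?[exact: mcabs|exact: cabs2i].
apply: le_trans cs; rewrite ler_sqr ?nnegrE ?cabs_ge0//; last first.
  by apply: Rintegral_ge0 => x _; rewrite mulr_ge0 ?cabs_ge0.
apply: (le_trans (cabs_cint_le measurableT fgi)).
by under eq_Rintegral do rewrite cabsM.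
Qed.

End SquareIntegrable.

Notation sqnorm := (sqnorm_on setT).

Section SquareIntegrableLimits.
Context {R : realType}.
Notation mu := (@lebesgue_measure R).
Implicit Types (S : set (measurableTypeR R)) (f g : R -> R[i]).

Lemma cvg_of_dist_le {I : Type} {F : set_system I} {FF : ProperFilter F}
    (x_ d : I -> R) (x : R) : 0 <= x ->
  (forall e, 0 < e ->
    \forall i \near F, `|x_ i - x| <= e * x + (1 + e^-1) * d i) ->
  d i @[i --> F] --> 0 -> x_ i @[i --> F] --> x.
Proof.
move=> x0 dist_le d0; apply/cvgrPdist_lt => eps eps0.
have x1 : 0 < x + 1 by rewrite ltr_wpDl.
pose e := eps / 2 / (x + 1).
have e0 : 0 < e by rewrite !divr_gt0.
have ie0 : 0 < 1 + e^-1 by rewrite addr_gt0 ?invr_gt0.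
near=> i; rewrite distrC; apply: (le_lt_trans (near (dist_le e e0) i _)) => //.
have ex : e * x <= eps / 2.
  rewrite /e mulrAC ler_pdivrMr// ler_wpM2l ?divr_ge0 ?(ltW eps0)//.
  by rewrite lerDl.
have : (1 + e^-1) * d i < eps / 2; last lra.
rewrite mulrC -ltr_pdivlMr// (le_lt_trans (ler_norm _))//.
near: i; have /cvgrPdist_lt := d0; move=> /(_ (eps / 2 / (1 + e^-1))).
rewrite !divr_gt0// => /(_ isT); apply: filterS => i.
by rewrite sub0r normrN.
Unshelve. all: by end_near. Qed.

Lemma sqn_cvg {I : Type} {F : set_system I} {FF : ProperFilter F}
    (a_ : I -> R[i]) (a : R[i]) :
  sqn (a_ i - a) @[i --> F] --> 0 -> sqn (a_ i) @[i --> F] --> sqn a.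
Proof.
apply: cvg_of_dist_le; first exact: sqn_ge0.
by move=> e e0; apply: nearW => i; exact: sqn_dist_le.
Qed.

Lemma sqnorm_on_cvg {I : Type} {F : set_system I} {FF : ProperFilter F}
    S (f_ : I -> R -> R[i]) f : measurable S -> L2 f ->
  (\forall i \near F, L2 (f_ i)) ->
  sqnorm (fun x => f_ i x - f x) @[i --> F] --> 0 ->
  sqnorm_on S (f_ i) @[i --> F] --> sqnorm_on S f.
Proof.
move=> mS Lf Lf_; apply: cvg_of_dist_le; first exact: sqnorm_on_ge0.
move=> e e0; apply: filterS Lf_ => i Lfi; have Lfd := L2B Lfi Lf.
have ie0 : 0 <= 1 + e^-1 by rewrite addr_ge0// invr_ge0 ltW.
have [fi f_i di] : [/\ mu.-integrable S (EFin \o (sqn \o f)),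
    mu.-integrable S (EFin \o (sqn \o f_ i)) &
    mu.-integrable S (EFin \o (fun x => sqn (f_ i x - f x)))].
  by split; exact: L2_integrable.
apply: (@le_trans _ _
    (e * sqnorm_on S f + (1 + e^-1) * sqnorm_on S (fun x => f_ i x - f x))).
  have diff_i := integrableB_EFin mS f_i fi.
  rewrite /sqnorm_on -RintegralB// -!RintegralZl// -RintegralD//;
    try exact: integrableZl_EFin.
  apply: (le_trans (le_normr_Rintegral mS diff_i)); apply: le_Rintegral => //.
  - exact: integrable_norm.
  - by apply: integrableD_EFin => //; exact: integrableZl_EFin.
  - by move=> x _; exact: sqn_dist_le.
by rewrite lerD2l ler_wpM2l// sqnorm_on_le.
Qed.

Lemma L2_fatou (f_ : nat -> R -> R[i]) f (C : R) : (forall n, L2 (f_ n)) ->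
  cmeasurable setT f -> (forall x, sqn (f_ n x - f x) @[n --> \oo] --> 0) ->
  (forall n, sqnorm (f_ n) <= C) -> L2 f /\ sqnorm f <= C.
Proof.
move=> Lf_ mf f_f f_C.
have [] := @fatou_Rintegral _ _ _ mu setT
  (fun n => sqn \o f_ n) (sqn \o f) C => //.
- by move=> n; exact: L2_integrable.
- by move=> n x; exact: sqn_ge0.
- by move=> x _; exact: sqn_cvg.
- by move=> fi fC; split=> //; apply/L2P.
Qed.

Definition trunc (T : R) f (x : R) : R[i] := if `|x| <= T then f x else 0.

Lemma truncE T f : trunc T f = fun x => f x * (\1_(`[- T, T]) x)%:C.
Proof.
apply/funext => x; rewrite /trunc indicE; case: ifPn => xT.
  by rewrite mem_set ?mulr1//= in_itv/= -ler_norml.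
by rewrite memNset ?mulr0//= in_itv/= -ler_norml; exact/negP.
Qed.

Lemma cmeasurable_trunc T f :
  cmeasurable setT f -> cmeasurable setT (trunc T f).
Proof.
move=> mf; rewrite truncE; apply: cmeasurableM => //.
exact/cmeasurable_real/measurable_indic.
Qed.

Lemma L2_trunc T f : L2 f -> L2 (trunc T f) /\ sqnorm (trunc T f) <= sqnorm f.
Proof.
move=> Lf; rewrite -[leRHS]mul1r; apply: L2_le => //.
  exact/cmeasurable_trunc/L2_cmeasurable.
move=> x; rewrite mul1r /trunc; case: ifPn => // _.
by rewrite {1}/sqn/= !expr0n addr0 sqn_ge0.
Qed.

Lemma cintegrable_trunc T f : L2 f -> cintegrable setT (trunc T f).
Proof.
move=> Lf; rewrite truncE; apply: cintegrable_mul => //; apply/L2P; split.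
  exact/cmeasurable_real/measurable_indic.
have := integrable_indic_itv (- T) T true false; congr (_.-integrable _ _).
apply/funext => x; rewrite /= /sqn/= expr0n addr0 indicE.
by case: (_ \in _); rewrite ?expr1n ?expr0n.
Qed.

Lemma sqnorm_trunc_cvg0 f : L2 f ->
  sqnorm (fun x => f x - trunc n%:R f x) @[n --> \oo] --> 0.
Proof.
move=> Lf; have mf := L2_cmeasurable Lf.
have [] := @dominated_cvg_Rintegral _ _ _ mu setT
  (fun n x => sqn (f x - trunc n%:R f x)) (fun=> 0) (sqn \o f) => //.
- move=> n; apply/measurable_sqn/cmeasurableB => //.
  exact: cmeasurable_trunc.
- move=> x _; apply: cvg_near_cst; near=> n; rewrite /trunc ifT.
    by rewrite subrr /sqn/= !expr0n addr0.
  by near: n; exact: nbhs_infty_ger.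
- exact: L2_integrable.
- move=> n x _; rewrite ger0_norm ?sqn_ge0// /trunc; case: ifPn => _.
    by rewrite subrr {1}/sqn/= !expr0n addr0 sqn_ge0.
  by rewrite subr0.
- by move=> _; rewrite Rintegral_cst// mul0r.
Unshelve. all: by end_near. Qed.

End SquareIntegrableLimits.

Section Convolution.
Context {R : realType}.
Notation mu := (@lebesgue_measure R).
Implicit Types (f g h r : R -> R[i]).

Definition convolve f g (w : R) : R[i] := cint setT (fun x => f x * g (w - x)).

Definition invol f (x : R) : R[i] := (f (- x))^*.

Lemma involK f : invol (invol f) = f.
Proof. by apply/funext => x; rewrite /invol opprK conjcK. Qed.

Lemma involE f : invol f = fun x => (f (0 - x))^*.
Proof. by apply/funext => x; rewrite sub0r. Qed.

Lemma L2_invol f : L2 f -> L2 (invol f).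
Proof. by move=> Lf; rewrite involE; exact/L2J/L2_reflect. Qed.

Lemma sqnorm_invol f : L2 f -> sqnorm (invol f) = sqnorm f.
Proof. by move=> Lf; rewrite involE sqnormJ sqnorm_reflect. Qed.

Lemma cintegrable_convolve f g w : L2 f -> L2 g ->
  cintegrable setT (fun x => f x * g (w - x)).
Proof. by move=> Lf Lg; apply: cintegrable_mul => //; exact: L2_reflect. Qed.

Lemma sqn_convolve_le f g w : L2 f -> L2 g ->
  sqn (convolve f g w) <= sqnorm f * sqnorm g.
Proof.
move=> Lf Lg; rewrite -(sqnorm_reflect w Lg); apply: sqn_cint_mul_le => //.
exact: L2_reflect.
Qed.

Lemma cmeasurable_convolve f g : cmeasurable setT f -> cmeasurable setT g ->
  cmeasurable setT (convolve f g).
Proof.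
move=> mf mg.
apply: (cmeasurable_cint_param (F := fun z => f z.2 * g (z.1 - z.2))).
apply: cmeasurableM; first exact: (cmeasurable_comp mf measurable_snd).
by apply: (cmeasurable_comp mg); exact: measurable_funB.
Qed.

Lemma convolveC f g : L2 f -> L2 g -> convolve f g = convolve g f.
Proof.
move=> Lf Lg; apply/funext => w; rewrite /convolve.
rewrite -(cint_reflect w (cintegrable_convolve w Lf Lg)).
by apply: eq_cint => x _; rewrite subKr mulrC.
Qed.

Lemma convolveBl f g h w : L2 f -> L2 g -> L2 h ->
  convolve (fun x => f x - g x) h w = convolve f h w - convolve g h w.
Proof.
move=> Lf Lg Lh; rewrite /convolve -cintB//; try exact: cintegrable_convolve.
by apply: eq_cint => x _; rewrite mulrBl.
Qed.

Lemma convolveBr f g h w : L2 f -> L2 g -> L2 h ->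
  convolve f (fun x => g x - h x) w = convolve f g w - convolve f h w.
Proof.
move=> Lf Lg Lh; rewrite (convolveC Lf (L2B Lg Lh)) convolveBl//.
by rewrite (convolveC Lg Lf) (convolveC Lh Lf).
Qed.

Lemma convolve_invol f g : L2 f -> L2 g ->
  convolve (invol f) (invol g) = invol (convolve f g).
Proof.
move=> Lf Lg; apply/funext => w; have fgi := cintegrable_convolve (- w) Lf Lg.
rewrite /invol /convolve -(cint_reflect 0 fgi) -cintJ//; last first.
  exact: (cintegrable_reflect 0 fgi).
by apply: eq_cint => x _; rewrite conjcM sub0r opprB opprK (addrC x).
Qed.

Lemma convolveA f g h : cintegrable setT f -> L2 f -> L2 g -> L2 h ->
  convolve f (convolve g h) = convolve (convolve f g) h.
Proof.
move=> fi Lf Lg Lh; apply/funext => w.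
pose K (z : R * R) := g (z.2 - z.1) * h (w - z.2).
have mK : cmeasurable setT K.
  apply: cmeasurableM; apply: cmeasurable_comp (measurable_funB _ _) => //;
    exact: L2_cmeasurable.
have KL x : L2 (fun y => g (y - x)) /\ L2 (fun y => h (w - y)).
  by split; [exact: L2_shift|exact: L2_reflect].
transitivity (cint setT (fun x => f x * cint setT (fun y => K (x, y)))).
  apply: eq_cint => x _; rewrite /convolve; congr (_ * _).
  rewrite -(cint_shift x (cintegrable_convolve (w - x) Lg Lh)).
  by apply: eq_cint => y _; rewrite /K/= opprB addrA subrK.
rewrite (cint_kernel_swap (B := sqnorm g + sqnorm h) fi mK); last 2 first.
- by move=> x; have [? ?] := KL x; exact: cintegrable_mul.
- move=> x; have [? ?] := KL x; rewrite -(sqnorm_shift x Lg).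
  by rewrite -(sqnorm_reflect w Lh) Rintegral_cabs_mul_le.
apply: eq_cint => y _; rewrite /convolve mulrC -cintZl//; last first.
  exact: cintegrable_convolve.
by apply: eq_cint => x _; rewrite /K/= mulrA mulrC.
Qed.

Definition inner f g : R[i] := cint setT (fun x => f x * (g x)^*).

Lemma cintegrable_inner f g : L2 f -> L2 g ->
  cintegrable setT (fun x => f x * (g x)^*).
Proof. by move=> Lf Lg; apply: cintegrable_mul => //; exact: L2J. Qed.

Lemma innerJ f g : L2 f -> L2 g -> (inner f g)^* = inner g f.
Proof.
move=> Lf Lg; rewrite /inner -cintJ//; last exact: cintegrable_inner.
by apply: eq_cint => x _; rewrite conjcM conjcK mulrC.
Qed.

Lemma innerBl f g h : L2 f -> L2 g -> L2 h ->
  inner (fun x => f x - g x) h = inner f h - inner g h.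
Proof.
move=> Lf Lg Lh; rewrite /inner -cintB//; try exact: cintegrable_inner.
by apply: eq_cint => x _; rewrite mulrBl.
Qed.

Lemma sqn_inner_le f g : L2 f -> L2 g -> sqn (inner f g) <= sqnorm f * sqnorm g.
Proof.
by move=> Lf Lg; rewrite -(sqnormJ g) sqn_cint_mul_le//; exact: L2J.
Qed.

Lemma inner_convolve_L1 f g r : cintegrable setT f -> L2 f -> L2 g -> L2 r ->
  inner (convolve f r) g = inner f (convolve g (invol r)).
Proof.
move=> fi Lf Lg Lr; pose K (z : R * R) := (g z.2)^* * r (z.2 - z.1).
have mK : cmeasurable setT K.
  apply: cmeasurableM.
    exact/cmeasurableJ/(cmeasurable_comp (L2_cmeasurable Lg) measurable_snd).
  by apply: (cmeasurable_comp (L2_cmeasurable Lr)); exact: measurable_funB.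
have KL x : L2 (fun y => (g y)^*) /\ L2 (fun y => r (y - x)).
  by split; [exact: L2J|exact: L2_shift].
transitivity (cint setT (fun x => f x * cint setT (fun y => K (x, y))));
  last first.
  apply: eq_cint => x _; congr (_ * _); rewrite /convolve -cintJ//; last first.
    exact: cintegrable_convolve (L2_invol Lr).
  by apply: eq_cint => y _; rewrite /K/invol/= conjcM conjcK opprB.
rewrite (cint_kernel_swap (B := sqnorm g + sqnorm r) fi mK); last 2 first.
- by move=> x; have [? ?] := KL x; exact: cintegrable_mul.
- move=> x; have [? ?] := KL x; rewrite -(sqnormJ g) -(sqnorm_shift x Lr).
  exact: Rintegral_cabs_mul_le.
apply: eq_cint => y _; rewrite mulrC -cintZl//; last first.
  exact: cintegrable_convolve.
by apply: eq_cint => x _; rewrite /K/= mulrCA.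
Qed.

End Convolution.

Section Multiplier.
Context {R : realType}.
Implicit Types (f g h r : R -> R[i]) (C : R).

Definition convolver C g := 0 <= C /\ forall f, L2 f ->
  L2 (convolve f g) /\ sqnorm (convolve f g) <= C * sqnorm f.

Lemma convolver_dense C g : 0 <= C -> L2 g ->
  (forall f, cintegrable setT f -> L2 f ->
    L2 (convolve f g) /\ sqnorm (convolve f g) <= C * sqnorm f) ->
  convolver C g.
Proof.
move=> C0 Lg convg; split=> [//|f Lf].
have fi_ n := cintegrable_trunc n%:R Lf.
have Lf_ n : L2 (trunc n%:R f) by have [] := L2_trunc n%:R Lf.
apply: (L2_fatou (f_ := fun n => convolve (trunc n%:R f) g)).
- by move=> n; have [] := convg _ (fi_ n) (Lf_ n).
- by apply: cmeasurable_convolve; exact: L2_cmeasurable.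
- move=> w; apply: (@squeeze_cvgr _ _ _ _ (fun=> 0)
    (fun n => sqnorm (fun x => f x - trunc n%:R f x) * sqnorm g)).
  + apply: nearW => n; rewrite sqn_ge0/= sqnC -convolveBl//.
    by rewrite sqn_convolve_le//; exact: L2B.
  + exact: cvg_cst.
  + rewrite -(mul0r (sqnorm g)); apply: cvgM; last exact: cvg_cst.
    exact: sqnorm_trunc_cvg0.
- move=> n; have [_ /le_trans] := convg _ (fi_ n) (Lf_ n); apply.
  by rewrite ler_wpM2l//; have [] := L2_trunc n%:R Lf.
Qed.

Lemma convolver_limit C (g_ : nat -> R -> R[i]) g : L2 g ->
  (forall n, L2 (g_ n)) -> (forall n, convolver C (g_ n)) ->
  sqnorm (fun x => g_ n x - g x) @[n --> \oo] --> 0 -> convolver C g.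
Proof.
move=> Lg Lg_ convg_ g_g; split=> [|f Lf]; first by have [] := convg_ 0%N.
apply: (L2_fatou (f_ := fun n => convolve f (g_ n))).
- by move=> n; have [] := (convg_ n).2 f Lf.
- by apply: cmeasurable_convolve; exact: L2_cmeasurable.
- move=> w; apply: (@squeeze_cvgr _ _ _ _ (fun=> 0)
    (fun n => sqnorm f * sqnorm (fun x => g_ n x - g x))).
  + apply: nearW => n; rewrite sqn_ge0/= -convolveBr//.
    by rewrite sqn_convolve_le//; exact: L2B.
  + exact: cvg_cst.
  + by rewrite -(mulr0 (sqnorm f)); apply: cvgM => //; exact: cvg_cst.
- by move=> n; have [] := (convg_ n).2 f Lf.
Qed.

Lemma convolver_invol C g : L2 g -> convolver C g -> convolver C (invol g).
Proof.
move=> Lg [C0 convg]; split=> [//|f Lf]; have Lf' := L2_invol Lf.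
have [Lfg fg_le] := convg _ Lf'.
rewrite -(involK f) convolve_invol// sqnorm_invol// [in X in _ /\ X]involK.
by split; [exact: L2_invol|rewrite -(sqnorm_invol Lf)].
Qed.

Lemma convolver_convolve Cg Ch g h : L2 g -> L2 h ->
  convolver Cg g -> convolver Ch h -> convolver (Ch * Cg) (convolve g h).
Proof.
move=> Lg Lh [Cg0 convg] [Ch0 convh].
apply: convolver_dense => [||f fi Lf]; first exact: mulr_ge0.
  by have [] := convh _ Lg.
have [Lfg fg_le] := convg _ Lf; have [Lfgh fgh_le] := convh _ Lfg.
rewrite convolveA//; split=> //; rewrite (le_trans fgh_le)// -mulrA.
exact: ler_wpM2l.
Qed.

Lemma inner_convolve C f g r : L2 f -> L2 g -> L2 r -> convolver C r ->
  inner (convolve f r) g = inner f (convolve g (invol r)).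
Proof.
move=> Lf Lg Lr convr; have [C0 conv_r] := convr.
have [_ conv_r'] := convolver_invol Lr convr.
have [Lgr gr_le] := conv_r' _ Lg.
pose D := inner (convolve f r) g - inner f (convolve g (invol r)).
pose rest n x := f x - trunc n%:R f x.
have Lf_ n : L2 (trunc n%:R f) by have [] := L2_trunc n%:R Lf.
have Lrest n : L2 (rest n) by exact: L2B.
have DE n : D =
    inner (convolve (rest n) r) g - inner (rest n) (convolve g (invol r)).
  have -> : convolve (rest n) r =
      fun w => convolve f r w - convolve (trunc n%:R f) r w.
    by apply/funext => w; rewrite convolveBl.
  have [[Lfr _] [Lf_r _]] := (conv_r _ Lf, conv_r _ (Lf_ n)).
  rewrite !innerBl// (inner_convolve_L1 (cintegrable_trunc n%:R Lf) (Lf_ n))//.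
  by rewrite opprB addrA subrK.
have D_le n : sqn D <= 4 * C * sqnorm g * sqnorm (rest n).
  rewrite (DE n); apply: (le_trans (sqnB_le _ _)).
  have [Lrr rr_le] := conv_r _ (Lrest n).
  have fst_le := le_trans (sqn_inner_le Lrr Lg)
    (ler_wpM2r (sqnorm_on_ge0 setT g) rr_le).
  have snd_le := le_trans (sqn_inner_le (Lrest n) Lgr)
    (ler_wpM2l (sqnorm_on_ge0 setT (rest n)) gr_le).
  rewrite (_ : 4 * C * _ * _ = 2 * (C * sqnorm (rest n) * sqnorm g +
    sqnorm (rest n) * (C * sqnorm g))); last by ring.
  by rewrite ler_wpM2l// lerD.
have D0 : sqn D <= 0.
  have cvg0 : 4 * C * sqnorm g * sqnorm (rest n) @[n --> \oo] --> 0.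
    rewrite -(mulr0 (4 * C * sqnorm g)); apply: cvgM; first exact: cvg_cst.
    exact: sqnorm_trunc_cvg0.
  rewrite -(cvg_lim _ cvg0)//; apply: limr_ge; last exact: nearW.
  by apply/cvg_ex; exists 0.
apply/eqP; rewrite -subr_eq0; apply/eqP/sqn_eq0/eqP.
by rewrite eq_le D0 sqn_ge0.
Qed.

End Multiplier.

(** * The Fourier transform of integrable functions *)

Section FourierTransform.
Context {R : realType}.
Notation mu := (@lebesgue_measure R).
Implicit Types (f g h : R -> R[i]) (w : R).

Definition FT h w : R[i] := cint setT (fun t => h t * cexpmi (w * t)).

Lemma cmeasurable_FT h : cmeasurable setT h -> cmeasurable setT (FT h).
Proof.
move=> mh.
apply: (cmeasurable_cint_param (F := fun z => h z.2 * cexpmi (z.1 * z.2))).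
apply: cmeasurableM; first exact: (cmeasurable_comp mh measurable_snd).
exact/cmeasurable_cexpmi/measurable_funM.
Qed.

Lemma cintegrable_cexpmi h w : cintegrable setT h ->
  cintegrable setT (fun t => h t * cexpmi (w * t)).
Proof.
move=> hi; apply: (cintegrableM_bounded (B := 1)) => // [|x].
  exact/cmeasurable_cexpmi/measurable_funM.
by rewrite cabs_cexpmi.
Qed.

Lemma cabs_FT_le h w : cintegrable setT h ->
  cabs (FT h w) <= \int[mu]_t cabs (h t).
Proof.
move=> hi; rewrite -[leRHS]mul1r; apply: cabs_cintM_bounded_le => // [|x].
  exact/cmeasurable_cexpmi/measurable_funM.
by rewrite cabs_cexpmi.
Qed.

Lemma cint_mul_FT f g : cintegrable setT f -> cintegrable setT g ->
  cint setT (fun w => f w * FT g w) = cint setT (fun t => FT f t * g t).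
Proof.
move=> fi gi; pose K (z : R * R) := g z.2 * cexpmi (z.1 * z.2).
have mg := cintegrable_cmeasurable measurableT gi.
have mK : cmeasurable setT K.
  apply: cmeasurableM; first exact: (cmeasurable_comp mg measurable_snd).
  exact/cmeasurable_cexpmi/measurable_funM.
rewrite /FT (cint_kernel_swap (B := \int[mu]_t cabs (g t)) fi mK).
- apply: eq_cint => t _; rewrite [RHS]mulrC -cintZl//; last first.
    exact: cintegrable_cexpmi.
  apply: eq_cint => w _; rewrite /K/= mulrCA; congr (_ * (_ * cexpmi _)).
  exact: mulrC.
- by move=> w; exact: cintegrable_cexpmi.
- by move=> w; under eq_Rintegral do rewrite cabsM cabs_cexpmi mulr1.
Qed.

Lemma FT_conj_reflect h (s w : R) : cintegrable setT h ->
  FT (fun u => (h (s - u))^*) w = (FT h w)^* * cexpmi (w * s).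
Proof.
move=> hi; have hei := cintegrable_cexpmi w hi.
rewrite /FT -cintJ// mulrC -cintZl//; last exact: cintegrableJ.
rewrite -[RHS](cint_reflect s); last first.
  by apply: cintegrableZl => //; exact: cintegrableJ.
apply: eq_cint => u _; rewrite conjcM conjc_cexpmi mulrCA -cexpmiD.
by congr (_ * cexpmi _); ring.
Qed.

Lemma cint_mul_sqn_FT (phi : R -> R[i]) h : cintegrable setT phi ->
  cintegrable setT h -> L2 h ->
  cint setT (fun w => phi w * (sqn (FT h w))%:C) =
  cint setT (fun u => FT phi u * convolve h (invol h) u).
Proof.
move=> phii hi Lh; have mh := cintegrable_cmeasurable measurableT hi.
have mFT f : cintegrable setT f -> cmeasurable setT (FT f).
  by move=> fi; exact/cmeasurable_FT/(cintegrable_cmeasurable measurableT fi).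
have hJi s : cintegrable setT (fun u => (h (s - u))^*).
  by apply: cintegrableJ => //; exact: cintegrable_reflect.
have phihi : cintegrable setT (fun w => phi w * (FT h w)^*).
  apply: (cintegrableM_bounded (B := \int[mu]_t cabs (h t))) => // [|w].
    exact/cmeasurableJ/mFT.
  by rewrite cabsJ cabs_FT_le.
transitivity (cint setT (fun w => phi w * (FT h w)^* * FT h w)).
  by apply: eq_cint => w _; rewrite -mulcJ_sqn -mulrA [FT h w * _]mulrC.
rewrite cint_mul_FT//.
pose K (z : R * R) := FT phi z.2 * (h (z.1 - z.2))^*.
transitivity (cint setT (fun s => h s * cint setT (fun u => K (s, u)))).
  apply: eq_cint => s _; rewrite mulrC -(cint_mul_FT phii (hJi s)).
  congr (_ * _).
  apply: eq_cint => w _; rewrite FT_conj_reflect// mulrA.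
  by congr (_ * cexpmi _); exact: mulrC.
have KM s u : cabs (K (s, u)) <= \int[mu]_w cabs (phi w) * cabs (h (s - u)).
  by rewrite cabsM cabsJ ler_wpM2r ?cabs_ge0 ?cabs_FT_le.
have Ki s : cintegrable setT (fun u => K (s, u)).
  rewrite /K; under eq_fun do rewrite mulrC.
  exact: cintegrableM_bounded measurableT (hJi s) (mFT _ phii)
    (fun u => cabs_FT_le u phii).
rewrite (cint_kernel_swap (K := K)
  (B := \int[mu]_w cabs (phi w) * \int[mu]_t cabs (h t)) hi).
- apply: eq_cint => u _; rewrite /convolve -cintZl//; last first.
    exact/cintegrable_convolve/L2_invol.
  by apply: eq_cint => s _; rewrite /K/invol/= opprB mulrCA.
- apply: cmeasurableM.
    exact: (cmeasurable_comp (mFT _ phii) measurable_snd).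
  by apply/cmeasurableJ/(cmeasurable_comp mh); exact: measurable_funB.
- exact: Ki.
- move=> s; have hsi := cintegrable_cabs measurableT (cintegrable_reflect s hi).
  rewrite -(Rintegral_reflect s (cintegrable_cabs measurableT hi)).
  rewrite -RintegralZl//.
  apply: le_Rintegral => //; [exact: cintegrable_cabs|exact: integrableZl_EFin].
Qed.

(* The weighted energy is the integral of [FT phi] against the autocorrelation
   of [h], which is bounded by its value [sqnorm h] at the origin. *)
Lemma weighted_sqn_FT_le (phi : R -> R) h :
  mu.-integrable setT (EFin \o phi) ->
  cintegrable setT (FT (fun w => (phi w)%:C)) -> cintegrable setT h -> L2 h ->
  \int[mu]_w (phi w * sqn (FT h w)) <=
  \int[mu]_u cabs (FT (fun w => (phi w)%:C) u) * sqnorm h.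
Proof.
move=> phii FTphii hi Lh.
have := cint_mul_sqn_FT (cintegrable_real measurableT phii) hi Lh.
under eq_cint do rewrite -rmorphM; rewrite cint_real => cintE.
apply: (le_trans (ler_norm _)); rewrite -cabs_real cintE mulrC.
apply: cabs_cintM_bounded_le => // [|u].
  by apply: cmeasurable_convolve; apply: L2_cmeasurable => //; exact: L2_invol.
rewrite cabs_le_sqn ?sqnorm_on_ge0// expr2 -{2}(sqnorm_invol Lh).
by rewrite sqn_convolve_le//; exact: L2_invol.
Qed.

Lemma convolve_FT f p : cintegrable setT f -> cintegrable setT p ->
  convolve f (FT p) = FT (fun t => p t * FT f (- t)).
Proof.
move=> fi pi; apply/funext => u; pose pu t := p t * cexpmi (u * t).
have pui : cintegrable setT pu by exact: cintegrable_cexpmi.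
have FTpu x : FT p (u - x) = FT pu (0 - x).
  apply: eq_cint => t _; rewrite /pu -mulrA -cexpmiD.
  by congr (_ * cexpmi _); ring.
have fFTi : cintegrable setT (fun x => f x * FT pu (0 - x)).
  apply: cintegrableM_bounded (fun x => cabs_FT_le (0 - x) pui) => //.
  apply: (cmeasurable_comp (cmeasurable_FT _)); last exact: measurable_funB.
  exact: cintegrable_cmeasurable pui.
rewrite /convolve; under eq_cint do rewrite FTpu.
rewrite -(cint_reflect 0 fFTi).
under eq_cint do rewrite subKr.
rewrite cint_mul_FT//; last exact: cintegrable_reflect.
apply: eq_cint => t _; rewrite /pu mulrA; congr (_ * _); rewrite mulrC.
congr (_ * _); have fei := cintegrable_cexpmi (- t) fi.
rewrite /FT -(cint_reflect 0 fei); apply: eq_cint => x _.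
by rewrite sub0r mulrNN.
Qed.

Lemma FT_even (u : R -> R) w : mu.-integrable setT (EFin \o u) ->
  (forall x, u (- x) = u x) ->
  FT (fun x => (u x)%:C) w = (\int[mu]_x (u x * cos (w * x)))%:C.
Proof.
move=> ui ueven.
have [_ imi] := cintegrable_cexpmi w (cintegrable_real measurableT ui).
apply: complex_ext.
  by apply: eq_Rintegral => x _; rewrite Re_mulc/= mul0r subr0.
set I := Im (FT _ w); suff : I = - I by rewrite /=; lra.
rewrite -[LHS](Rintegral_reflect 0 imi) -mulN1r -RintegralZl//.
apply: eq_Rintegral => x _; rewrite !Im_mulc/= !mul0r !addr0 sub0r ueven.
by rewrite (mulrN w) sinN opprK mulN1r mulrN opprK.
Qed.

End FourierTransform.

(** * Bessel's inequality *)

Section RieszWeight.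
Context {R : realType}.
Notation mu := (@lebesgue_measure R).
Implicit Types (K w x y : R).

Lemma Rintegral_FTC (F f : R -> R) (a b : R) : a <= b ->
  (forall x, a <= x <= b -> is_derive x 1 F (f x)) -> continuous f ->
  \int[mu]_(x in `[a, b]) f x = F b - F a.
Proof.
rewrite le_eqVlt => /predU1P[<- _ _|ab dF cf].
  by rewrite set_itv1 Rintegral_set1 subrr.
have cF x : a <= x <= b -> {for x, continuous F}.
  move=> /dF dFx; apply: differentiable_continuous; apply/derivable1_diffP.
  exact: ex_derive.
rewrite /Rintegral (@continuous_FTC2 _ f F)//.
- by apply: continuous_subspaceT.
- split.
  + move=> x; rewrite in_itv/= => /andP[ax xb].
    by have [] := dF x _; rewrite ?(ltW ax) ?(ltW xb).
  + by apply: cvg_at_right_filter; apply: cF; rewrite lexx ltW.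
  + by apply: cvg_at_left_filter; apply: cF; rewrite lexx ltW.
- move=> x; rewrite in_itv/= => /andP[ax xb]; rewrite derive1E.
  by have [] := dF x _; rewrite ?(ltW ax) ?(ltW xb).
Qed.

(* Unlike that of the indicator of [-K, K], the transform of this weight is
   bounded in L1 uniformly in [K]. *)
Definition riesz_weight K w : R := (1 - (w / K) ^+ 2) * \1_(`[- K, K]) w.

Lemma riesz_weight_ge0 K w : 0 < K -> 0 <= riesz_weight K w.
Proof.
move=> K0; rewrite /riesz_weight indicE; case: (boolP (w \in _)); last first.
  by rewrite mulr0.
rewrite inE/= in_itv/= mulr1 -ler_norml => wK.
rewrite subr_ge0 -[leLHS]ger0_norm ?sqr_ge0// normrX expr_le1//.
by rewrite normrM normfV (gtr0_norm K0) ler_pdivrMr// mul1r.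
Qed.

Lemma riesz_weight_le K w : riesz_weight K w <= \1_(`[- K, K]) w.
Proof. by rewrite /riesz_weight ler_piMl// lerBlDr lerDl sqr_ge0. Qed.

Lemma riesz_weightN K w : riesz_weight K (- w) = riesz_weight K w.
Proof.
rewrite /riesz_weight mulNr sqrrN !indicE; congr (_ * (_ : bool)%:R).
by apply/idP/idP; rewrite !inE/= !in_itv/= -!ler_norml normrN.
Qed.

Lemma integrable_riesz_weight K : 0 < K ->
  mu.-integrable setT (EFin \o riesz_weight K).
Proof.
move=> K0.
apply: (le_integrable_EFin _ _ (integrable_indic_itv (- K) K true false)) => //.
  apply: measurable_funM; last exact: measurable_indic.
  by apply: measurable_funB => //; apply/measurable_funX/measurable_funM.
move=> w _; rewrite ger0_norm ?riesz_weight_ge0//; exact: riesz_weight_le.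
Qed.

Lemma riesz_weight_cvg w : riesz_weight n.+1%:R w @[n --> \oo] --> (1 : R).
Proof.
apply: (@cvg_trans _ ((1 - (w * n.+1%:R^-1) * (w * n.+1%:R^-1)) @[n --> \oo])).
  apply: near_eq_cvg; near=> n.
  rewrite /riesz_weight indicE mem_set ?mulr1 ?expr2//=.
  rewrite in_itv/= -ler_norml; near: n.
  have := nbhs_infty_ger `|w|; apply: filterS => n.
  by move/le_trans; apply; rewrite ler_nat.
have cvg0 : w * n.+1%:R^-1 @[n --> \oo] --> (0 : R).
  by rewrite -(mulr0 w); apply: cvgM; [exact: cvg_cst|exact: cvg_harmonic].
have cvg1 : 1 - (w * n.+1%:R^-1) * (w * n.+1%:R^-1)
    @[n --> \oo] --> (1 - 0 * 0 : R).
  by apply: cvgB; [exact: cvg_cst|exact: cvgM].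
by rewrite mulr0 subr0 in cvg1.
Unshelve. all: by end_near. Qed.

Let riesz_primitive K x w : R :=
  (1 - (w * K^-1) * (w * K^-1)) * (sin (x * w) * x^-1)
  - 2 * K^-1 * K^-1 * x^-1 * x^-1 * (w * cos (x * w))
  + 2 * K^-1 * K^-1 * x^-1 * x^-1 * x^-1 * sin (x * w).

Let is_derive_riesz_primitive K x w : x != 0 -> K != 0 ->
  is_derive w 1 (riesz_primitive K x) ((1 - (w / K) ^+ 2) * cos (x * w)).
Proof.
move=> x0 K0; rewrite /riesz_primitive; apply: is_derive_eq.
by rewrite /GRing.scale/=; field; exact/andP.
Qed.

Lemma Rintegral_riesz_weight_cos K x : 0 < K -> x != 0 ->
  let y := K * x in
  \int[mu]_w (riesz_weight K w * cos (x * w)) =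
  4 * K * (sin y - y * cos y) * y^-1 ^+ 3.
Proof.
move=> K0 x0 y; have Kn0 : K != 0 by rewrite gt_eqF.
transitivity (\int[mu]_(w in `[- K, K]) ((1 - (w / K) ^+ 2) * cos (x * w))).
  rewrite [RHS]Rintegral_mkcond; apply: eq_Rintegral => w _.
  rewrite patchE /riesz_weight indicE; case: ifPn => _; first by rewrite mulr1.
  by rewrite mulr0 mul0r.
transitivity (riesz_primitive K x K - riesz_primitive K x (- K)).
  apply: Rintegral_FTC; first by rewrite ge0_cp// ltW.
    by move=> w _; exact: is_derive_riesz_primitive.
  move=> w; apply: differentiable_continuous; apply/derivable1_diffP.
  exact: ex_derive.
rewrite /riesz_primitive !mulrN sinN cosN (mulrC x K) -/y /y.
by field; apply/andP.
Qed.

Definition poisson_kernel K x : R := K / (1 + (K * x) ^+ 2).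

Let norm_riesz_transform_le K y : 0 < K -> 1 < `|y| ->
  `|4 * K * (sin y - y * cos y) * y^-1 ^+ 3| <= 16 * (K / (1 + y ^+ 2)).
Proof.
move=> K0 y1; have yn0 : y != 0 by rewrite -normr_gt0 (lt_trans _ y1).
have y2_ge1 : 1 <= y ^+ 2 by rewrite -(real_normK (num_real y)) expr_ge1// ltW.
have sin_cos_le : `|sin y - y * cos y| <= 2 * `|y|.
  rewrite (le_trans (ler_normB _ _))// normrM.
  by have := sin_max y; have := cos_max y; have := normr_ge0 (cos y); nra.
rewrite mulrA ler_pdivlMr; last by lra.
rewrite 2!normrM normrX normfV [`|4 * K|]ger0_norm; last first.
  by rewrite mulr_ge0// ltW.
apply: (@le_trans _ _ (4 * K * (2 * `|y|) * `|y|^-1 ^+ 3 * (1 + y ^+ 2))).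
  rewrite ler_wpM2r ?addr_ge0 ?sqr_ge0// ler_wpM2r ?exprn_ge0 ?invr_ge0//.
  by rewrite ler_wpM2l// mulr_ge0// ltW.
rewrite [leLHS](_ : _ = 8 * K * (1 + (y ^+ 2)^-1)); last first.
  by rewrite -(real_normK (num_real y)); field; rewrite normr_eq0.
have : (y ^+ 2)^-1 <= 1 by rewrite invf_le1// (lt_le_trans _ y2_ge1).
by nra.
Qed.

Lemma cabs_FT_riesz_weight_le K x : 0 < K ->
  cabs (FT (fun w => (riesz_weight K w)%:C) x) <= 16 * poisson_kernel K x.
Proof.
move=> K0; have Wi := integrable_riesz_weight K0.
rewrite /poisson_kernel; set y := K * x; have y2 := sqr_ge0 y.
have [y_le1|y_gt1] := leP `|y| 1; last first.
  have x0 : x != 0.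
    by apply: contraTneq y_gt1 => x0; rewrite /y x0 mulr0 normr0 -leNgt ler01.
  rewrite FT_even ?cabs_real//; last exact: riesz_weightN.
  by rewrite Rintegral_riesz_weight_cos// norm_riesz_transform_le.
apply: (@le_trans _ _ (2 * K)); last first.
  have : y ^+ 2 <= 1 by rewrite -(real_normK (num_real y)) expr_le1.
  by rewrite mulrA ler_pdivlMr; [nra|lra].
apply: (le_trans (cabs_FT_le x (cintegrable_real measurableT Wi))).
have -> : 2 * K = \int[mu]_w (\1_(`[- K, K]) w).
  have muK : mu `[- K, K]%classic = (2 * K)%:E.
    rewrite lebesgue_measure_itv/= lte_fin ifT ?gtrN// -EFinB opprK.
    by congr (_%:E); ring.
  by rewrite /Rintegral integral_indic// setIT; have /= -> := muK.
apply: le_Rintegral => //.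
- by under eq_fun do rewrite cabs_real; exact: integrable_norm.
- exact: integrable_indic_itv.
- move=> w _; rewrite cabs_real ger0_norm ?riesz_weight_ge0//.
  exact: riesz_weight_le.
Qed.

Lemma poisson_kernel_ge0 K x : 0 <= K -> 0 <= poisson_kernel K x.
Proof. by move=> K0; rewrite divr_ge0// addr_ge0// sqr_ge0. Qed.

Lemma continuous_poisson_kernel K : continuous (poisson_kernel K).
Proof.
move=> x; rewrite /poisson_kernel; apply: cvgM; first exact: cvg_cst.
apply: cvgV; first by have := sqr_ge0 (K * x); lra.
apply: cvgD; first exact: cvg_cst.
by apply: cvgM; (apply: cvgM; [exact: cvg_cst|exact: cvg_id]).
Qed.

Lemma integral_poisson_kernel K : 0 < K ->
  (\int[mu]_x (poisson_kernel K x)%:E = pi%:E)%E.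
Proof.
move=> K0; have cp := @continuous_poisson_kernel K.
rewrite ge0_symfun_integralT//; last 2 first.
- by move=> x; exact/poisson_kernel_ge0/ltW.
- by move=> x; rewrite /poisson_kernel /= mulrN sqrrN.
have dF (x : R) : is_derive x 1 (fun x => atan (K * x)) (poisson_kernel K x).
  by apply: is_derive_eq; rewrite /poisson_kernel /GRing.scale/= mulr1 mulrC.
rewrite -set_itvcy.
rewrite (@ge0_continuous_FTC2y _ _ (fun x => atan (K * x)) 0 (pi / 2)).
- by rewrite mulr0 atan0 sube0 -EFinM; congr (_%:E); field.
- by move=> x _; exact/poisson_kernel_ge0/ltW.
- exact: continuous_subspaceT.
- have Kx : K * x @[x --> +oo%R] --> +oo%R.
    by apply: gt0_cvgMry => //; exact: cvg_id.
  exact: (cvg_comp (fun x => K * x) (@atan R) Kx (@cvgy_atan R)).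
- by move=> x _; have [] := dF x.
- apply: cvg_at_right_filter.
  apply: differentiable_continuous; apply/derivable1_diffP.
  by have [] := dF 0.
- by move=> x _; rewrite derive1E; have [] := dF x.
Qed.

End RieszWeight.

Section Bessel.
Context {R : realType}.
Notation mu := (@lebesgue_measure R).
Implicit Types (h : R -> R[i]) (K : R).

Let weight K (w : R) : R[i] := (riesz_weight K w)%:C.

Let FT_riesz_weight_L1 K : 0 < K -> cintegrable setT (FT (weight K)) /\
  \int[mu]_u cabs (FT (weight K) u) <= 16 * pi.
Proof.
move=> K0; have Wi := cintegrable_real measurableT (integrable_riesz_weight K0).
have pi_int : mu.-integrable setT (EFin \o poisson_kernel K).
  apply/integrableP; split.
    apply/measurable_EFinP; apply: continuous_measurable_fun.
    exact: continuous_poisson_kernel.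
  under eq_integral do rewrite /= ger0_norm ?poisson_kernel_ge0 ?(ltW K0)//.
  by rewrite integral_poisson_kernel// ltry.
have pi16 := integrableZl_EFin 16 measurableT pi_int.
have FTi : cintegrable setT (FT (weight K)).
  apply: (le_cintegrable _ _ pi16) => //.
    exact/cmeasurable_FT/(cintegrable_cmeasurable measurableT Wi).
  by move=> x _; exact: cabs_FT_riesz_weight_le.
split=> //; have -> : pi = \int[mu]_x poisson_kernel K x :> R.
  by rewrite /Rintegral integral_poisson_kernel.
rewrite -RintegralZl//; apply: le_Rintegral => //.
  exact: cintegrable_cabs.
by move=> x _; exact: cabs_FT_riesz_weight_le.
Qed.

Lemma bessel h : cintegrable setT h -> L2 h ->
  L2 (FT h) /\ sqnorm (FT h) <= 16 * pi * sqnorm h.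
Proof.
move=> hi Lh; have mFT : cmeasurable setT (FT h).
  exact/cmeasurable_FT/(cintegrable_cmeasurable measurableT hi).
have [] := @fatou_Rintegral _ _ _ mu setT
  (fun n w => riesz_weight n.+1%:R w * sqn (FT h w)) (sqn \o FT h)
  (16 * pi * sqnorm h) => //.
- move=> n; have Wi := integrable_riesz_weight (ltr0Sn R n).
  have WFTi := cintegrableM_bounded measurableT
    (cintegrable_real measurableT Wi) (cmeasurableM mFT (cmeasurableJ mFT))
    (B := (\int[mu]_t cabs (h t)) ^+ 2).
  have [|+ _] := WFTi.
    move=> w; rewrite cabsM cabsJ -expr2.
    rewrite ler_sqr ?nnegrE ?cabs_ge0 ?cabs_FT_le//.
    by apply: Rintegral_ge0 => t _; exact: cabs_ge0.
  by under eq_fun do rewrite mulcJ_sqn -rmorphM.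
- by move=> n w; rewrite mulr_ge0 ?riesz_weight_ge0 ?sqn_ge0.
- move=> w _; have cvg1 : riesz_weight n.+1%:R w * sqn (FT h w)
      @[n --> \oo] --> 1 * sqn (FT h w).
    by apply: cvgM; [exact: riesz_weight_cvg|exact: cvg_cst].
  by rewrite mul1r in cvg1.
- move=> n; have n0 := ltr0Sn R n; have [FTWi FTW_le] := FT_riesz_weight_L1 n0.
  have Wi := integrable_riesz_weight n0.
  apply: (le_trans (weighted_sqn_FT_le Wi FTWi hi Lh)).
  by rewrite ler_wpM2r ?sqnorm_on_ge0.
- by move=> FTi FT_le; split=> //; apply/L2P.
Qed.

End Bessel.

(** * Transforms of bounded signals and the nonlinear term *)

Section BoundedSignal.
Context {R : realType}.
Notation mu := (@lebesgue_measure R).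
Implicit Types (f p q Q : R -> R[i]) (M T : R).

Lemma L2_bounded M p :
  cintegrable setT p -> (forall t, cabs (p t) <= M) -> L2 p.
Proof.
move=> /(cintegrableP _ measurableT)[mp pi] pM; apply/L2P; split=> //.
apply: le_integrable_EFin (integrableZl_EFin M measurableT pi) _ => //.
  exact: measurable_sqn mp.
move=> t _; rewrite /= ger0_norm ?sqn_ge0// -sqr_cabs expr2.
by rewrite ler_wpM2r ?cabs_ge0.
Qed.

Definition convolver_const M : R := (16 * pi * M) ^+ 2.

(* [convolve f (FT p)] is the transform of [p] times a transform of [f], so that
   Bessel's inequality applies twice. *)
Lemma convolver_FT M p : cintegrable setT p -> (forall t, cabs (p t) <= M) ->
  convolver (convolver_const M) (FT p).
Proof.
move=> p_i pM; have Lp := L2_bounded p_i pM; have [LFTp _] := bessel p_i Lp.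
apply: convolver_dense => // [|f fi Lf]; first exact: sqr_ge0.
have [LFTf FTf_le] := bessel fi Lf.
pose FTN (t : R) := FT f (- t); pose pf t := p t * FTN t.
have [LFTN FTN_le] : L2 FTN /\ sqnorm FTN <= 16 * pi * sqnorm f.
  rewrite /FTN; under eq_fun do rewrite -sub0r; rewrite sqnorm_reflect//.
  by split=> //; exact: L2_reflect.
have pfi : cintegrable setT pf.
  exact: cintegrableM_bounded measurableT p_i (L2_cmeasurable LFTN)
    (fun t : R => cabs_FT_le (- t) fi).
have [Lpf pf_le] : L2 pf /\ sqnorm pf <= M ^+ 2 * sqnorm FTN.
  apply: L2_le => //; first exact: cintegrable_cmeasurable pfi.
  move=> t; rewrite sqnM ler_wpM2r ?sqn_ge0// -cabs_le_sqn ?pM//.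
  exact: le_trans (cabs_ge0 _) (pM t).
have [LFTpf FTpf_le] := bessel pfi Lpf; rewrite convolve_FT//; split=> //.
have pi16 : 0 <= 16 * pi :> R by rewrite mulr_ge0// pi_ge0.
rewrite (_ : convolver_const M * _ = 16 * pi * (M ^+ 2 * (16 * pi * sqnorm f)));
  last by rewrite /convolver_const; ring.
apply: (le_trans FTpf_le); rewrite ler_wpM2l// (le_trans pf_le)//.
by rewrite ler_wpM2l ?sqr_ge0.
Qed.

Lemma cintegrable_trunc_itv T q : cintegrable `[- T, T] q ->
  cintegrable setT (trunc T q).
Proof.
have truncP (P : R[i] -> R) : P 0 = 0 ->
    mu.-integrable `[- T, T] (EFin \o (P \o q)) ->
    mu.-integrable setT (EFin \o (P \o trunc T q)).
  move=> P0 Pi; rewrite (_ : P \o _ = (P \o q) \_ `[- T, T]).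
    by rewrite -restrict_EFin; apply/integrable_restrict => //; rewrite setTI.
  apply/funext => t; rewrite /= patchE /trunc mem_setE in_itv/= -ler_norml.
  by case: ifPn.
by move=> [rei imi]; split; exact: truncP.
Qed.

Lemma truncFT_FT T q : truncFT q T = FT (trunc T q).
Proof.
apply/funext => w; apply: complex_ext; rewrite /= Rintegral_mkcond;
  apply: eq_Rintegral => t _;
  rewrite patchE /trunc mem_setE in_itv/= -ler_norml;
  by case: ifPn => // _; rewrite mul0r.
Qed.

Lemma is_FT_convolver M q Q :
  L2 Q -> is_FT q Q -> (forall t, cabs (q t) <= M) ->
  convolver (convolver_const M) Q.
Proof.
move=> LQ [q_int q_cvg] qM.
have trunc_int T : cintegrable setT (trunc T q).
  apply: cintegrable_trunc_itv; have := q_int T 0; congr (cintegrable _ _).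
  by apply/funext => t; rewrite mul0r cexpmi0 mulr1.
have truncM T t : cabs (trunc T q t) <= M.
  rewrite /trunc; case: ifPn => // _; apply: le_trans (qM t).
  by rewrite /cabs /sqn/= !expr0n addr0 sqrtr0 cabs_ge0.
apply: (convolver_limit (g_ := fun n => truncFT q n%:R)) => //.
- move=> n; rewrite truncFT_FT.
  by have [] := bessel (trunc_int n%:R) (L2_bounded (trunc_int _) (truncM _)).
- by move=> n; rewrite truncFT_FT; exact: convolver_FT.
- apply: (fine_cvg (cvg_comp (fun n : nat => n%:R : R)
    (fun T => L2dist2 (truncFT q T) Q) _ q_cvg)).
  exact: cvgr_idn.
Qed.

End BoundedSignal.

Section NonlinearTerm.
Context {R : realType}.
Notation mu := (@lebesgue_measure R).
Variables (Q : R -> R[i]) (C : R).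
Hypotheses (LQ : L2 Q) (convQ : convolver C Q).

Let autocorrelation := convolve Q (invol Q).

Let convolver_invol_Q : convolver C (invol Q).
Proof. exact: convolver_invol. Qed.

Let L2_autocorrelation :
  L2 autocorrelation /\ sqnorm autocorrelation <= C * sqnorm Q.
Proof. exact: convolver_invol_Q.2. Qed.

Let invol_autocorrelation : invol autocorrelation = autocorrelation.
Proof.
by rewrite -convolve_invol ?involK ?(convolveC (L2_invol _))//; exact: L2_invol.
Qed.

Let convolver_autocorrelation : convolver (C * C) autocorrelation.
Proof. by apply: convolver_convolve => //; exact: L2_invol. Qed.

Lemma nltermE : nlterm Q = convolve Q autocorrelation.
Proof.
apply/funext => w; apply: eq_cint => w1 _.
have LQi := cintegrable_convolve (w - w1) LQ (L2_invol LQ).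
rewrite /autocorrelation /convolve -(cint_shift (w1 - w) LQi).
rewrite -cintZl//; last first.
  exact: (cintegrable_shift (w1 - w) LQi).
apply: eq_cint => w2 _; rewrite /nlinner /invol -mulrA; congr (_ * _).
rewrite mulrC; congr (Q _ * (Q _)^*); ring.
Qed.

Lemma L2_nlterm : L2 (nlterm Q) /\ sqnorm (nlterm Q) <= C * C * sqnorm Q.
Proof. by rewrite nltermE; exact: convolver_autocorrelation.2. Qed.

Lemma sqn_nlterm_le w : sqn (nlterm Q w) <= C * sqnorm Q ^+ 2.
Proof.
have [Lr r_le] := L2_autocorrelation; rewrite nltermE.
apply: (le_trans (sqn_convolve_le w LQ Lr)); rewrite expr2 mulrCA.
by rewrite ler_wpM2l// sqnorm_on_ge0.
Qed.

(* Convolution with the autocorrelation, which is a Hermitian function, is a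
   self-adjoint operator. *)
Lemma Im_inner_nlterm : Im (inner Q (nlterm Q)) = 0.
Proof.
have [Lr _] := L2_autocorrelation; have [LN _] := L2_nlterm.
have selfadjoint : inner (nlterm Q) Q = inner Q (nlterm Q).
  rewrite nltermE (inner_convolve LQ LQ Lr convolver_autocorrelation).
  by rewrite invol_autocorrelation.
have := congr1 (@complex.Im R) (innerJ LN LQ).
by rewrite selfadjoint Im_conjc => /eqP; rewrite eq_sym -addr_eq0; lra.
Qed.

End NonlinearTerm.

(** * Fundamental theorem of calculus under the integral sign *)

Section LipschitzFTC.
Context {R : realType}.
Notation mu := (@lebesgue_measure R).
Implicit Types (u v : R -> R) (s t x : R).

Lemma continuous_integrable_itv v s t : continuous v ->
  mu.-integrable `[s, t] (EFin \o v).
Proof.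
move=> cv; apply: continuous_compact_integrable; first exact: segment_compact.
exact: continuous_subspaceT.
Qed.

Lemma continuous_integrable_itvoo v s t : continuous v ->
  mu.-integrable `]s, t[ (EFin \o v).
Proof.
move=> cv; apply: integrableS (continuous_integrable_itv s t cv) => //.
exact: subset_itv_oo_cc.
Qed.

Lemma Rintegral_itv_oo_cc v s t : continuous v ->
  \int[mu]_(x in `]s, t[) v x = \int[mu]_(x in `[s, t]) v x.
Proof.
move=> cv; rewrite Rintegral_itv_obnd_cbnd; last first.
  exact: continuous_integrable_itvoo.
rewrite Rintegral_itv_bndo_bndc//.
apply: integrableS (continuous_integrable_itv s t cv) => //.
exact: subset_itv_co_cc.
Qed.

Lemma is_derive_cvg_seq u x (d : R) (h : nat -> R) :
  is_derive x 1 u d -> (forall n, h n != 0) -> h n @[n --> \oo] --> 0 ->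
  (u (x + h n) - u x) / h n @[n --> \oo] --> d.
Proof.
move=> [du <-] h0 hcv; have := du; rewrite /derivable => /cvg_ex[/= l ul].
have -> : 'D_1 u x = l by exact: cvg_lim ul.
rewrite (_ : (fun n => _) = (fun n => (h n)^-1 *: (u (h n *: 1 + x) - u x))).
  exact: ((cvgr_dnbhsP _ _ _).1 ul h (conj h0 hcv)).
by apply/funext => n /=; rewrite scaler1 [h n + x]addrC /GRing.scale/= mulrC.
Qed.

Lemma lipschitz_continuous v (L : R) :
  (forall x y, `|v x - v y| <= L * `|x - y|) -> continuous v.
Proof.
move=> vL x; apply/cvgrPdist_lt => e e0.
have L1 : 0 < `|L| + 1 by rewrite ltr_wpDl.
near=> y; rewrite (le_lt_trans (vL x y))//.
rewrite (@le_lt_trans _ _ ((`|L| + 1) * `|x - y|))//.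
  by rewrite ler_wpM2r// (le_trans (ler_norm _))// lerDl.
rewrite mulrC -ltr_pdivlMr//.
near: y; apply: (@cvgr_dist_lt _ _ _ _ _ id); first exact: cvg_id.
by rewrite divr_gt0.
Unshelve. all: by end_near. Qed.

Let step (n : nat) : R := n.+1%:R^-1.

Let step_gt0 n : 0 < step n. Proof. by rewrite invr_gt0. Qed.

Let step_neq0 n : step n != 0. Proof. by rewrite gt_eqF. Qed.

Let step_le1 n : step n <= 1. Proof. by rewrite invf_le1// ler1n. Qed.

Let step_cvg0 : step n @[n --> \oo] --> 0. Proof. exact: cvg_harmonic. Qed.

(* The difference quotients telescope: their integral is the difference of the
   averages of [v] over [t, t + h] and over [s, s + h]. *)
Lemma Rintegral_difference_quotient_cvg v s t : s <= t -> continuous v ->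
  \int[mu]_(x in `[s, t]) ((v (x + step n) - v x) / step n) @[n --> \oo] -->
  v t - v s.
Proof.
move=> st cv; pose V x := \int[mu]_(y in `[s - 1, x]) v y.
have dV x : s <= x <= t + 1 -> is_derive x 1 V (v x).
  move=> /andP[sx xt].
  have xt2 : x < t + 2 by lra.
  have sx1 : s - 1 < x by lra.
  have [dd dE] := continuous_FTC1_closed xt2
    (continuous_integrable_itv (s - 1) (t + 2) cv) sx1 (cv x).
  by split; [exact: dd|rewrite -derive1E; exact: dE].
have cvn n : continuous (fun x => v (x + step n)).
  move=> x; apply: continuous_comp; last exact: cv.
  by apply: cvgD; [exact: cvg_id|exact: cvg_cst].
have quotientE n : \int[mu]_(x in `[s, t]) ((v (x + step n) - v x) / step n) =
    (V (t + step n) - V t) / step n - (V (s + step n) - V s) / step n.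
  have i1 := continuous_integrable_itv s t (cvn n).
  have i2 := continuous_integrable_itv s t cv.
  rewrite RintegralZr// ?RintegralB//; last exact: integrableB_EFin.
  have -> : \int[mu]_(x in `[s, t]) v (x + step n) =
      V (t + step n) - V (s + step n).
    apply: (@Rintegral_FTC _ (fun x => V (x + step n))) => // x /andP[sx xt].
    have dVx : is_derive (x + step n) 1 V (v (x + step n)).
      by apply: dV; have := step_gt0 n; have := step_le1 n; lra.
    have dshift : is_derive x 1 (fun y : R => y + step n) (1 : R).
      by apply: is_derive_eq; rewrite addr0.
    have := @is_derive1_comp _ V (fun y => y + step n) x _ _ dVx dshift.
    by rewrite mulr1.
  have -> : \int[mu]_(x in `[s, t]) v x = V t - V s.
    by apply: Rintegral_FTC => // x /andP[sx xt]; apply: dV; lra.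
  by rewrite -mulrBl; congr (_ / _); ring.
under eq_fun do rewrite quotientE.
by apply: cvgB; apply: is_derive_cvg_seq => //; apply: dV; lra.
Qed.

Let clamp s t x : R := Num.max s (Num.min t x).

Let clamp_itv s t x : s <= t -> s <= clamp s t x <= t.
Proof. by move=> st; rewrite /clamp le_max lexx ge_max st ge_min lexx. Qed.

Let clamp_id s t x : s <= x <= t -> clamp s t x = x.
Proof. by move=> /andP[sx xt]; rewrite /clamp min_r// max_r. Qed.

Let clamp_dist_le s t x y : `|clamp s t x - clamp s t y| <= `|x - y|.
Proof.
have max_dist a b c : `|Num.max a b - Num.max a c| <= `|b - c| :> R.
  have [?|?] := leP a b; have [?|?] := leP a c; rewrite ?subrr ?normr0//;
    by rewrite ler_norml; have [?|?] := ger0P (b - c); lra.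
have min_dist a b c : `|Num.min a b - Num.min a c| <= `|b - c| :> R.
  have [?|?] := leP a b; have [?|?] := leP a c; rewrite ?subrr ?normr0//;
    by rewrite ler_norml; have [?|?] := ger0P (b - c); lra.
exact: le_trans (max_dist _ _ _) (min_dist _ _ _).
Qed.

Lemma lipschitz_FTC u (du : R -> R) s t (L : R) : s < t ->
  (forall x y, s <= x <= t -> s <= y <= t -> `|u x - u y| <= L * `|x - y|) ->
  (forall x, s < x < t -> is_derive x 1 u (du x)) ->
  mu.-integrable `]s, t[ (EFin \o du) /\
  \int[mu]_(x in `]s, t[) du x = u t - u s.
Proof.
move=> st uL dud; have st' := ltW st.
have L0 : 0 <= L.
  have := uL s t; rewrite !lexx st' => /(_ isT isT)/(le_trans (normr_ge0 _)).
  by rewrite pmulr_lge0// normr_gt0 subr_eq0 lt_eqF.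
pose v x := u (clamp s t x).
have vL x y : `|v x - v y| <= L * `|x - y|.
  apply: le_trans (uL _ _ (clamp_itv x st') (clamp_itv y st')) _.
  by rewrite ler_wpM2l ?clamp_dist_le.
have cv := lipschitz_continuous vL.
pose D n x := (v (x + step n) - v x) / step n.
have cD n : continuous (D n).
  move=> x; apply: cvgM; last exact: cvg_cst.
  apply: cvgB; last exact: cv.
  apply: (@lipschitz_continuous (fun x => v (x + step n)) L) => y z.
  by apply: le_trans (vL _ _) _; rewrite opprD addrACA subrr addr0.
have D_cvg x : `]s, t[%classic x -> D n x @[n --> \oo] --> du x.
  rewrite /= in_itv/= => /andP[sx xt].
  have dx : is_derive x 1 u (du x) by apply: dud; rewrite sx.
  apply: cvg_trans (is_derive_cvg_seq dx step_neq0 step_cvg0).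
  apply: near_eq_cvg; near=> n; rewrite /D /v !clamp_id ?(ltW sx) ?(ltW xt)//=.
  apply/andP; split; first by rewrite (le_trans (ltW sx))// lerDl ltW.
  rewrite -lerBrDl; near: n.
  have tx : 0 < t - x by rewrite subr_gt0.
  have /cvgrPdist_lt/(_ _ tx) := step_cvg0; apply: filterS => n.
  by rewrite sub0r normrN gtr0_norm// => /ltW.
have [du_int D_lim] : mu.-integrable `]s, t[ (EFin \o du) /\
    \int[mu]_(x in `]s, t[) D n x @[n --> \oo] --> \int[mu]_(x in `]s, t[) du x.
  apply: (@dominated_cvg_Rintegral _ _ _ mu _ _ _ (fun=> L)) => //.
  - by move=> n; apply: measurable_funTS; exact: continuous_measurable_fun.
  - by apply: continuous_integrable_itvoo => x; exact: cvg_cst.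
  - move=> n x _; rewrite /D normrM normfV (gtr0_norm (step_gt0 n)).
    rewrite ler_pdivrMr// (le_trans (vL _ _))// [x + _]addrC addrK.
    by rewrite gtr0_norm.
split=> //; have := Rintegral_difference_quotient_cvg st' cv.
under eq_fun do rewrite -(Rintegral_itv_oo_cc _ _ (cD _)).
move=> /(cvg_lim (@Rhausdorff R)).
rewrite (cvg_lim (@Rhausdorff R) D_lim) => ->.
by rewrite /v !clamp_id ?lexx ?st'.
Unshelve. all: by end_near. Qed.

Lemma within_continuousS u s t x y : s <= x -> y <= t ->
  {within `[s, t], continuous u} -> {within `[x, y], continuous u}.
Proof.
move=> sx yt; apply: continuous_subspaceW.
by apply: subset_itv; rewrite bnd_simp.
Qed.

Lemma bounded_derive_lipschitz u (du : R -> R) s t (G : R) :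
  {within `[s, t], continuous u} ->
  (forall z, s < z < t -> is_derive z 1 u (du z)) ->
  (forall z, s < z < t -> `|du z| <= G) ->
  forall x y, s <= x <= t -> s <= y <= t -> `|u x - u y| <= G * `|x - y|.
Proof.
move=> cu dud duG.
have lt_case x y : s <= x -> x < y -> y <= t -> `|u y - u x| <= G * `|y - x|.
  move=> sx xy yt; have itvS z : z \in `]x, y[ -> s < z < t.
    rewrite in_itv/= => /andP[xz zy].
    by rewrite (le_lt_trans sx) ?(lt_le_trans zy).
  have dxy z : z \in `]x, y[ -> is_derive z 1 u (du z) by move=> /itvS/dud.
  have [z /itvS zst ->] := MVT xy dxy (within_continuousS sx yt cu).
  by rewrite normrM ler_wpM2r// duG.
move=> x y /andP[sx xt] /andP[sy yt].
have [xy|yx|->] := ltgtP x y; last by rewrite !subrr normr0 mulr0.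
  by rewrite distrC [`|x - y|]distrC lt_case.
exact: lt_case.
Qed.

End LipschitzFTC.

Section ParametricFTC.
Context d {T : measurableType d} {R : realType}.
Variable m : {measure set T -> \bar R}.
Notation mu := (@lebesgue_measure R).
Variables (f df : R -> T -> R) (S : set T) (s t : R).
Hypotheses (st : s < t) (mS : measurable S).
Hypothesis f_cont : forall w, S w -> {within `[s, t], continuous (f ^~ w)}.
Hypothesis f_deriv : forall z w, s < z < t -> S w ->
  is_derive z 1 (f ^~ w) (df z w).
Hypothesis f_int : forall z, s <= z <= t -> m.-integrable S (EFin \o f z).

Lemma dominated_FTC (G : T -> R) : (forall w, 0 <= G w) ->
  m.-integrable S (EFin \o G) ->
  (forall z w, s < z < t -> S w -> `|df z w| <= G w) ->
  mu.-integrable `]s, t[ (EFin \o (fun z => \int[m]_(w in S) df z w)) /\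
  \int[mu]_(z in `]s, t[) \int[m]_(w in S) df z w =
  \int[m]_(w in S) f t w - \int[m]_(w in S) f s w.
Proof.
move=> G0 Gi df_le; apply: (@lipschitz_FTC _ (fun z => \int[m]_(w in S) f z w)
  _ s t (\int[m]_(w in S) G w)) => //.
- move=> x y hx hy; rewrite -RintegralB//; [|exact: f_int|exact: f_int].
  have fxyi : m.-integrable S (EFin \o (fun w => f x w - f y w)).
    by apply: integrableB_EFin => //; exact: f_int.
  apply: (le_trans (le_normr_Rintegral mS fxyi)).
  rewrite -RintegralZr//; apply: le_Rintegral => //.
  + exact: integrable_norm.
  + by under eq_fun do rewrite mulrC; exact: integrableZl_EFin.
  + move=> w Sw; apply: (bounded_derive_lipschitz (f_cont Sw)) => //.
    * by move=> z hz; exact: f_deriv.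
    * by move=> z hz; exact: df_le.
- move=> z hz; have Iz : `]s, t[%classic z by rewrite /= in_itv.
  have dfE x w : `]s, t[%classic x -> S w -> partial1of2 f x w = df x w.
    by rewrite /= in_itv/= partial1of2E => hx Sw; case: (f_deriv hx Sw).
  have intf x : `]s, t[%classic x -> m.-integrable S (EFin \o f x).
    by rewrite /= in_itv/= => /andP[? ?]; apply: f_int; rewrite !ltW.
  have derf x w : `]s, t[%classic x -> S w -> derivable (f ^~ w) x 1.
    by rewrite /= in_itv/= => hx Sw; have [] := f_deriv hx Sw.
  have Gub x w : `]s, t[%classic x -> S w -> `|partial1of2 f x w| <= G w.
    by move=> hx Sw; rewrite dfE//; apply: df_le.
  have dI := derivable_under_integral mS Iz intf derf G0 Gi Gub.
  split; first exact: dI.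
  rewrite -derive1E (differentiation_under_integral mS Iz intf derf G0 Gi Gub).
  by apply: eq_Rintegral => w /set_mem Sw; rewrite dfE.
Qed.

End ParametricFTC.

Section ParametricFTCExhaustion.
Context {R : realType}.
Notation mu := (@lebesgue_measure R).
Implicit Types S : set (measurableTypeR R).

Lemma Rintegral_setI_cvg S (f : R -> R) : measurable S ->
  mu.-integrable S (EFin \o f) ->
  \int[mu]_(w in S `&` `[- n%:R, n%:R]) f w @[n --> \oo] -->
  \int[mu]_(w in S) f w.
Proof.
move=> mS fi; have mf := measurable_int_EFin fi.
under eq_fun do rewrite Rintegral_mkcondr.
have [] := @dominated_cvg_Rintegral _ _ _ mu S
  (fun n => f \_ `[- n%:R, n%:R]) f (fun x => `|f x|) => //.
- move=> n; apply/measurable_restrict => //.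
  by apply: measurable_funS mf => //; exact: subIsetl.
- move=> x Sx; apply: cvg_near_cst; near=> n.
  rewrite patchE mem_set//= in_itv/= -ler_norml.
  by near: n; exact: nbhs_infty_ger.
- exact: integrable_norm.
- by move=> n x _; rewrite patchE; case: ifPn => // _; rewrite normr0.
Unshelve. all: by end_near. Qed.

Variables (f df : R -> R -> R) (S : set (measurableTypeR R)) (s t : R).
Hypotheses (st : s < t) (mS : measurable S).
Hypothesis f_cont : forall w, S w -> {within `[s, t], continuous (f ^~ w)}.
Hypothesis f_deriv : forall z w, s < z < t -> S w ->
  is_derive z 1 (f ^~ w) (df z w).
Hypothesis f_int : forall z, s <= z <= t -> mu.-integrable S (EFin \o f z).
Hypothesis df_int : forall z, s < z < t -> mu.-integrable S (EFin \o df z).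

Lemma locally_dominated_FTC (G : R -> R) (B : R) : (forall w, 0 <= G w) ->
  (forall n : nat, mu.-integrable (S `&` `[- n%:R, n%:R]) (EFin \o G)) ->
  (forall z w, s < z < t -> S w -> `|df z w| <= G w) ->
  (forall z, s < z < t -> \int[mu]_(w in S) `|df z w| <= B) ->
  mu.-integrable `]s, t[ (EFin \o (fun z => \int[mu]_(w in S) df z w)) /\
  \int[mu]_(z in `]s, t[) \int[mu]_(w in S) df z w =
  \int[mu]_(w in S) f t w - \int[mu]_(w in S) f s w.
Proof.
move=> G0 G_int df_le df_B; have st' := ltW st.
pose S_ (n : nat) := S `&` `[- n%:R, n%:R].
have mS_ n : measurable (S_ n).
  by apply: measurableI => //; exact: measurable_itv.
have S_S n : S_ n `<=` S by exact: subIsetl.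
have FTC_n n := @dominated_FTC _ _ _ mu f df (S_ n) s t st (mS_ n)
  (fun w Sw => f_cont (S_S n w Sw)) (fun z w hz Sw => f_deriv hz (S_S n w Sw))
  (fun z hz => integrableS mS (mS_ n) (@S_S n) (f_int hz)) G G0 (G_int n)
  (fun z w hz Sw => df_le z w hz (S_S n w Sw)).
have [d_int d_lim] : mu.-integrable `]s, t[
      (EFin \o (fun z => \int[mu]_(w in S) df z w)) /\
    \int[mu]_(z in `]s, t[) \int[mu]_(w in S_ n) df z w @[n --> \oo] -->
    \int[mu]_(z in `]s, t[) \int[mu]_(w in S) df z w.
  apply: (@dominated_cvg_Rintegral _ _ _ mu _ _ _ (fun=> B)) => //.
  - by move=> n; exact: measurable_int_EFin (FTC_n n).1.
  - move=> z /=; rewrite in_itv/= => hz.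
    by apply: Rintegral_setI_cvg => //; exact: df_int.
  - by apply: continuous_integrable_itvoo => x; exact: cvg_cst.
  - move=> n z /=; rewrite in_itv/= => hz; apply: le_trans (df_B z hz).
    have dfi := integrableS mS (mS_ n) (@S_S n) (df_int hz).
    apply: (le_trans (le_normr_Rintegral (mS_ n) dfi)).
    apply: ge0_subset_Rintegral => //; exact: integrable_norm (df_int hz).
split=> //; have f_lim : \int[mu]_(w in S_ n) f t w - \int[mu]_(w in S_ n) f s w
    @[n --> \oo] --> \int[mu]_(w in S) f t w - \int[mu]_(w in S) f s w.
  by apply: cvgB; apply: Rintegral_setI_cvg => //; apply: f_int;
    rewrite lexx ?st'.
move: d_lim; under eq_fun do rewrite (FTC_n _).2.
by move=> /(cvg_lim (@Rhausdorff R)) <-; exact: cvg_lim f_lim.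
Qed.

End ParametricFTCExhaustion.

(** * Energy balance *)

Section EnergyBalance.
Context {R : realType}.
Notation mu := (@lebesgue_measure R).
Implicit Types (p dp : R -> R) (S : set (measurableTypeR R)) (s t z c : R).

Lemma continuous_expRM c : continuous (fun z : R => expR (c * z)).
Proof.
move=> z; apply: continuous_comp; last exact: continuous_expR.
exact: mulrl_continuous.
Qed.

Lemma Rintegral_itvoo_expRM c t : 0 <= t -> c != 0 ->
  \int[mu]_(z in `]0, t[) expR (c * z) = (expR (c * t) - 1) / c.
Proof.
move=> t0 c_neq0; rewrite Rintegral_itv_oo_cc; last exact: continuous_expRM.
transitivity (expR (c * t) / c - expR (c * 0) / c); last first.
  by rewrite mulr0 expR0 -mulrBl.
apply: (@Rintegral_FTC _ (fun z => expR (c * z) / c)) => //.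
  by move=> z _; apply: is_derive_eq; rewrite /GRing.scale/=; field.
exact: continuous_expRM.
Qed.

Lemma Rintegral_itvoo_expRN_affine_le c t A B : 0 < c -> 0 < t -> 0 <= A ->
  mu.-integrable `]0, t[ (EFin \o (fun z => A * expR (- c * z) + B)) /\
  \int[mu]_(z in `]0, t[) (A * expR (- c * z) + B) <= A / c + B * t.
Proof.
move=> c0 t0 A0.
have mI : measurable (`]0, t[%classic : set (measurableTypeR R)).
  exact: measurable_itv.
have expi := continuous_integrable_itvoo 0 t (@continuous_expRM (- c)).
have Bi := continuous_integrable_itvoo 0 t (@cst_continuous R R B).
have Aexpi := integrableZl_EFin A mI expi.
have mu0t : fine (mu `]0, t[) = t.
  by rewrite lebesgue_measure_itv/= lte_fin t0 oppr0 addr0.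
split; first exact: integrableD_EFin.
rewrite RintegralD// RintegralZl// Rintegral_cst// mu0t.
rewrite Rintegral_itvoo_expRM ?(ltW t0) ?oppr_eq0 ?gt_eqF// lerD2r ler_wpM2l//.
by rewrite invrN mulrN -mulNr opprB ler_pdivrMr// mulVf ?gt_eqF.
Qed.

Lemma gronwall p dp s t c :
  {within `[s, t], continuous p} ->
  (forall z, s < z < t -> is_derive z 1 p (dp z)) ->
  (forall z, s < z < t -> dp z <= c * p z) ->
  forall z, s <= z <= t -> p z <= p s * expR (c * (z - s)).
Proof.
move=> cp dpd dp_le z /andP[sz zt].
have [<-|sz_neq] := eqVneq s z; first by rewrite subrr mulr0 expR0 mulr1.
have {sz_neq sz} sz : s < z by rewrite lt_neqAle sz_neq.
pose g x := expR (- c * x) * p x.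
pose dg x := expR (- c * x) * (dp x - c * p x).
have itvS x : x \in `]s, z[ -> s < x < t.
  by rewrite in_itv/= => /andP[-> xz]; rewrite (lt_le_trans xz).
have dgd x : x \in `]s, z[ -> is_derive x 1 g (dg x).
  move=> /itvS/dpd dpx; rewrite /g; apply: is_derive_eq.
  by rewrite /dg /GRing.scale/=; ring.
have cg : {within `[s, z], continuous g}.
  move=> x; apply: cvgM; last exact: (within_continuousS (lexx s) zt cp).
  exact: (continuous_subspaceT (@continuous_expRM (- c))).
have [x /itvS xst gE] := MVT sz dgd cg.
have g_le : g z <= g s.
  rewrite -subr_le0 gE mulr_le0_ge0// ?subr_ge0 ?(ltW sz)//.
  by rewrite mulr_ge0_le0 ?expR_ge0// subr_le0 dp_le.
have -> : p z = expR (c * z) * g z.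
  by rewrite /g mulrA -expRD mulNr subrr expR0 mul1r.
have -> : p s * expR (c * (z - s)) = expR (c * z) * g s.
  by rewrite /g mulrA -expRD mulrC; congr (expR _ * _); ring.
by rewrite ler_pM2l// expR_gt0.
Qed.

Lemma expR_itv_le (lambda s t z : R) : s <= z <= t ->
  expR (lambda * z) <= expR (`|lambda| * (`|s| + `|t|)).
Proof.
move=> /andP[sz zt]; rewrite ler_expR (le_trans (ler_norm _))// normrM.
rewrite ler_wpM2l//; have [z0|z0] := ger0P z; have := ler_norm t;
  have := ler_norm (- s); rewrite normrN; have := normr_ge0 s;
  have := normr_ge0 t; lra.
Qed.

Variables (P H : R -> R -> R) (S : set (measurableTypeR R)).
Variables (s t alpha lambda c M M' : R).
Hypotheses (st : s < t) (mS : measurable S) (c0 : 0 <= c).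
Hypothesis P_ge0 : forall z w, 0 <= P z w.
Hypothesis P_cont : forall w, S w -> {within `[s, t], continuous (P ^~ w)}.
Hypothesis P_deriv : forall z w, s < z < t -> S w ->
  is_derive z 1 (P ^~ w) (- alpha * P z w + H z w).
Hypothesis H_le : forall z w, s < z < t -> S w -> `|H z w| <= c * (P z w + 1).
Hypothesis P_int : forall z, s <= z <= t -> mu.-integrable S (EFin \o P z).
Hypothesis H_int : forall z, s < z < t -> mu.-integrable S (EFin \o H z).
Hypothesis P_int_le : forall z, s <= z <= t -> \int[mu]_(w in S) P z w <= M.
Hypothesis H_int_le : forall z, s < z < t -> \int[mu]_(w in S) `|H z w| <= M'.

Let itv_ooW z : s < z < t -> s <= z <= t.
Proof. by case/andP => ? ?; rewrite !ltW. Qed.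

Let growth := expR ((`|alpha| + c) * (t - s)).

Let P_le z w : s <= z <= t -> S w -> P z w + 1 <= (P s w + 1) * growth.
Proof.
move=> szt Sw; have /andP[sz zt] := szt; pose p x := P x w + 1.
have pd x : s < x < t -> is_derive x 1 p (- alpha * P x w + H x w).
  move=> hx; have dP := P_deriv hx Sw; rewrite /p; apply: is_derive_eq.
  by rewrite addr0.
have p_cont : {within `[s, t], continuous p}.
  by move=> x; apply: cvgD; [exact: P_cont|exact: cvg_cst].
have pd_le x : s < x < t -> - alpha * P x w + H x w <= (`|alpha| + c) * p x.
  move=> hx; have := le_trans (ler_norm _) (H_le hx Sw).
  have : - alpha * P x w <= `|alpha| * P x w.
    by rewrite ler_wpM2r// -normrN ler_norm.
  by rewrite /p; have := P_ge0 x w; have := normr_ge0 alpha; nra.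
apply: le_trans (gronwall p_cont pd pd_le szt) _.
rewrite ler_wpM2l ?addr_ge0// ler_expR ler_wpM2l ?addr_ge0//.
by rewrite lerB.
Qed.

Let wP z w := expR (lambda * z) * P z w.
Let dwP z w := expR (lambda * z) * ((lambda - alpha) * P z w + H z w).

Let dwP_le z w : s < z < t -> S w ->
  `|dwP z w| <= expR (`|lambda| * (`|s| + `|t|)) *
    ((`|lambda - alpha| + c) * growth * (P s w + 1)).
Proof.
move=> szt Sw; have szt' := itv_ooW szt.
rewrite normrM ger0_norm ?expR_ge0//.
apply: ler_pM; rewrite ?expR_ge0 ?expR_itv_le//.
apply: (@le_trans _ _ ((`|lambda - alpha| + c) * (P z w + 1))).
  apply: le_trans (ler_normD _ _) _; rewrite normrM (ger0_norm (P_ge0 z w)).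
  have := H_le szt Sw; have := normr_ge0 (lambda - alpha).
  by have := P_ge0 z w; nra.
by rewrite -mulrA ler_wpM2l ?addr_ge0// mulrC P_le.
Qed.

Let dwP_int z : s < z < t -> mu.-integrable S (EFin \o dwP z).
Proof.
move=> szt; have szt' := itv_ooW szt.
apply: integrableZl_EFin => //.
apply: integrableD_EFin => //; last exact: H_int.
by apply: integrableZl_EFin => //; exact: P_int.
Qed.

Let dwP_int_le z : s < z < t -> \int[mu]_(w in S) `|dwP z w| <=
  expR (`|lambda| * (`|s| + `|t|)) * (`|lambda - alpha| * M + M').
Proof.
move=> szt; have szt' := itv_ooW szt.
have Pi := P_int szt'; have Hi := integrable_norm (H_int szt).
have sumi := integrableD_EFin mS (integrableZl_EFin `|lambda - alpha| mS Pi) Hi.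
apply: (@le_trans _ _ (\int[mu]_(w in S)
    (expR (lambda * z) * (`|lambda - alpha| * P z w + `|H z w|)))).
  apply: le_Rintegral => //.
  - exact: integrable_norm (dwP_int szt).
  - exact: integrableZl_EFin.
  move=> w _; rewrite normrM ger0_norm ?expR_ge0// ler_wpM2l ?expR_ge0//.
  by rewrite (le_trans (ler_normD _ _))// normrM (ger0_norm (P_ge0 z w)).
rewrite RintegralZl// RintegralD//; last exact: integrableZl_EFin.
rewrite RintegralZl//; apply: ler_pM; rewrite ?expR_ge0 ?expR_itv_le//.
  rewrite addr_ge0//; last by apply: Rintegral_ge0 => w _.
  by rewrite mulr_ge0//; apply: Rintegral_ge0 => w _.
by rewrite lerD ?H_int_le// ler_wpM2l ?P_int_le.
Qed.

Lemma energy_balance :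
  let d z := expR (lambda * z) *
    ((lambda - alpha) * \int[mu]_(w in S) P z w + \int[mu]_(w in S) H z w) in
  mu.-integrable `]s, t[ (EFin \o d) /\
  \int[mu]_(z in `]s, t[) d z =
    expR (lambda * t) * \int[mu]_(w in S) P t w -
    expR (lambda * s) * \int[mu]_(w in S) P s w.
Proof.
move=> d; have st' := ltW st.
have s_in : s <= s <= t by rewrite lexx.
have t_in : s <= t <= t by rewrite lexx st'.
have dE z : s < z < t -> \int[mu]_(w in S) dwP z w = d z.
  move=> szt; have szt' := itv_ooW szt.
  have Pi := P_int szt'; have Hi := H_int szt.
  have lPi := integrableZl_EFin (lambda - alpha) mS Pi.
  by rewrite RintegralZl ?RintegralD ?RintegralZl//; exact: integrableD_EFin.
pose G w := expR (`|lambda| * (`|s| + `|t|)) *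
  ((`|lambda - alpha| + c) * growth * (P s w + 1)).
have G_ge0 w : 0 <= G w by rewrite !mulr_ge0 ?addr_ge0 ?expR_ge0.
have G_int (n : nat) : mu.-integrable (S `&` `[- n%:R, n%:R]) (EFin \o G).
  have mSn : measurable (S `&` `[- n%:R, n%:R]%classic).
    by apply: measurableI => //; exact: measurable_itv.
  apply: integrableZl_EFin => //; apply: integrableZl_EFin => //.
  apply: integrableD_EFin => //; first exact: integrableS (P_int s_in).
  have one_int :=
    continuous_integrable_itv (- n%:R) n%:R (@cst_continuous R R 1).
  by apply: integrableS one_int.
have wP_cont w : S w -> {within `[s, t], continuous (wP ^~ w)}.
  move=> Sw x; apply: cvgM; last exact: P_cont.
  exact: (continuous_subspaceT (@continuous_expRM lambda)).
have wP_deriv z w : s < z < t -> S w -> is_derive z 1 (wP ^~ w) (dwP z w).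
  move=> szt Sw; have dP := P_deriv szt Sw; rewrite /wP; apply: is_derive_eq.
  by rewrite /dwP /GRing.scale/=; ring.
have wP_int z : s <= z <= t -> mu.-integrable S (EFin \o wP z).
  by move=> szt; apply: integrableZl_EFin => //; exact: P_int.
have [di dI] := locally_dominated_FTC st mS wP_cont wP_deriv wP_int dwP_int
  G_ge0 G_int dwP_le dwP_int_le.
split.
  apply: eq_integrable di => // z /set_mem/=; rewrite in_itv/= => szt.
  by rewrite dE.
rewrite -!RintegralZl//; [|exact: P_int..]; rewrite -dI.
by apply: eq_Rintegral => z /set_mem/=; rewrite in_itv/= => szt; rewrite dE.
Qed.

End EnergyBalance.

(** * Local boundedness of the energy *)

Section LocallyBounded.
Context {R : realType}.
Variables (E : R -> R) (k : R).
Implicit Types a b m s t x y z : R.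

Definition bounded_on s t := exists B, forall z, s <= z <= t -> E z <= B.

Hypothesis k0 : 0 <= k.
Hypothesis E_ge0 : forall z, 0 <= E z.
Hypothesis E_lsc : forall x m, 0 < x -> m < E x ->
  exists2 e, 0 < e & forall z, x - e <= z <= x -> 0 <= z -> m < E z.
Hypothesis E_decr : forall s t, 0 <= s -> s < t -> bounded_on s t -> E t <= E s.
Hypothesis E_growth : forall s t, 0 <= s -> s < t -> bounded_on s t ->
  E s <= expR (k * (t - s)) * E t.

Lemma bounded_onS s t s' t' :
  s <= s' -> t' <= t -> bounded_on s t -> bounded_on s' t'.
Proof.
move=> ss tt [B EB]; exists B => z /andP[sz zt]; apply: EB.
by rewrite (le_trans ss)// (le_trans zt).
Qed.

Lemma bounded_on_cat s t u : bounded_on s t -> bounded_on t u -> bounded_on s u.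
Proof.
move=> [B EB] [B' EB']; exists (Num.max B B') => z /andP[sz zu].
rewrite le_max; have [zt|tz] := leP z t; first by rewrite EB// sz.
by rewrite EB' ?orbT// (ltW tz).
Qed.

Lemma bounded_on_closure x y : 0 <= x -> x <= y ->
  (forall s, x < s <= y -> bounded_on s y) -> bounded_on x y.
Proof.
move=> x0 xy bounded_right.
exists (Num.max (E x) (expR (k * (y - x)) * E y)) => z /andP[xz zy].
rewrite le_max; move: xz; rewrite le_eqVlt => /predU1P[<-|xz].
  by rewrite lexx.
apply/orP; right; move: zy; rewrite le_eqVlt => /predU1P[zy|zy].
  by rewrite zy ler_peMl// -[leLHS]expR0 ler_expR mulr_ge0// subr_ge0.
have Ezy : bounded_on z y by apply: bounded_right; rewrite xz ltW.
apply: le_trans (E_growth (le_trans x0 (ltW xz)) zy Ezy) _.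
by rewrite ler_wpM2r// ler_expR ler_wpM2l// lerB// ltW.
Qed.

(* Going left from a point where [E] exceeds [m], [E] stays above [m] by
   monotonicity until its boundedness fails. *)
Lemma unbounded_left_of_large a b m : 0 <= a -> E a <= m -> ~ bounded_on a b ->
  exists x, [/\ a < x <= b, m < E x & forall s, a <= s < x -> ~ bounded_on s x].
Proof.
move=> a0 Ea nb; have [y /andP[ay yb] Ey] : exists2 y, a <= y <= b & m < E y.
  apply: contra_notP nb => small; exists m => z zab; rewrite leNgt.
  by apply/negP => mz; apply: small; exists z.
pose A := [set s | a <= s <= y /\ bounded_on s y].
have lbA : lbound A a by move=> s [/andP[]].
have Ay : A y.
  by split; [rewrite ay lexx|exists (E y) => z; rewrite -eq_le => /eqP->].
have infA : has_inf A by split; [exists y|exists a].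
pose x := inf A; have ax : a <= x by apply: lb_le_inf => //; exists y.
have xy : x <= y by apply: inf_lbound => //; exists a.
have bxy : bounded_on x y.
  apply: bounded_on_closure => // [|s /andP[xs sy]]; first exact: le_trans ax.
  have sx0 : 0 < s - x by rewrite subr_gt0.
  have [r [_ br] rs] := inf_adherent sx0 infA.
  apply: bounded_onS br => //.
  by rewrite ltW// (lt_le_trans rs)// -/x addrC subrK.
have mx : m < E x.
  apply: lt_le_trans Ey _.
  move: xy bxy; rewrite le_eqVlt => /predU1P[->//|xy] bxy.
  by apply: E_decr => //; exact: le_trans ax.
exists x; split=> //.
  rewrite (le_trans xy yb) andbT lt_neqAle ax andbT.
  by apply: contraPneq mx => <-; apply/negP; rewrite -leNgt.
move=> s /andP[az zx] bsx; have : x <= s.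
  apply: inf_lbound; first by exists a.
  split; last exact: bounded_on_cat bxy.
  by rewrite az (le_trans (ltW zx)).
by rewrite leNgt zx.
Qed.

Lemma unbounded_refine a b m : 0 <= a -> ~ bounded_on a b ->
  exists a' b', [/\ a <= a', a' < b', b' <= b, ~ bounded_on a' b' &
    forall z, a' <= z <= b' -> m < E z].
Proof.
move=> a0 nb; have Ea : E a <= Num.max m (E a) by rewrite le_max lexx orbT.
have [x [/andP[ax xb] Ex nbx]] := unbounded_left_of_large a0 Ea nb.
have mx : m < E x by apply: le_lt_trans Ex; rewrite le_max lexx.
have [e e0 large] := E_lsc (le_lt_trans a0 ax) mx.
pose a' := Num.max a (x - e).
have a'x : a' < x by rewrite gt_max ax ltrBlDr ltrDl.
have aa' : a <= a' by rewrite le_max lexx.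
exists a', x; split=> //; first by apply: nbx; rewrite aa'.
move=> z /andP[a'z zx].
apply: large; last exact: le_trans (le_trans a0 aa') a'z.
by rewrite zx andbT (le_trans _ a'z)// le_max lexx orbT.
Qed.

Let bad (ab : R * R) := [/\ 0 <= ab.1, ab.1 <= ab.2 & ~ bounded_on ab.1 ab.2].

Lemma nested_unbounded a b : 0 <= a -> a <= b -> ~ bounded_on a b ->
  exists I : nat -> R * R, forall n, bad (I n) /\
    [/\ (I n).1 <= (I n.+1).1, (I n.+1).2 <= (I n).2 &
     forall z, (I n.+1).1 <= z <= (I n.+1).2 -> n%:R < E z].
Proof.
move=> a0 ab nb.
have refine (n : nat) (x : {ab | bad ab}) : {y : {ab | bad ab} |
    [/\ (sval x).1 <= (sval y).1, (sval y).2 <= (sval x).2 &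
    forall z, (sval y).1 <= z <= (sval y).2 -> n%:R < E z]}.
  apply: cid; case: x => -[u v] [/= u0 uv nuv].
  have [u' [v' [uu uv' vv nuv' large]]] := unbounded_refine n%:R u0 nuv.
  have bad' : bad (u', v') by split=> /=; [exact: le_trans uu|exact: ltW|].
  by exists (exist _ (u', v') bad').
have badab : bad (a, b) by [].
pose I := fix I n :=
  if n is j.+1 then sval (refine j (I j)) else exist _ (a, b) badab.
exists (fun n => sval (I n)) => n; split; first exact: (svalP (I n)).
exact: (svalP (refine n (I n))).
Qed.

Lemma locally_bounded a b : 0 <= a -> a <= b -> bounded_on a b.
Proof.
move=> a0 ab; apply: contrapT => nb.
have [I I_nested] := nested_unbounded a0 ab nb.
have I1 : {homo (fun n => (I n).1) : i j / (i <= j)%N >-> i <= j}.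
  apply: homo_leq => [//|? ? ?|n]; first exact: le_trans.
  by have [_ []] := I_nested n.
have I2 : {homo (fun n => (I n).2) : i j / (i <= j)%N >-> j <= i}.
  apply: homo_leq => [//|? ? ? h1 h2|n]; first exact: le_trans h2 h1.
  by have [_ []] := I_nested n.
have I12 i j : (I i).1 <= (I j).2.
  apply: le_trans (I1 _ _ (leq_maxl i j)) (le_trans _ (I2 _ _ (leq_maxr i j))).
  by have [[]] := I_nested (maxn i j).
pose A := [set (I n).1 | n in setT].
have ubA n : ubound A (I n).2 by move=> _ [j _ <-].
have supA : has_sup A by split; [exists (I 0%N).1; exists 0%N|exists (I 0%N).2].
have E_sup n : n%:R < E (sup A).
  have [_ [_ _]] := I_nested n; apply; apply/andP; split.
    by apply: sup_upper_bound => //; exists n.+1.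
  by apply: ge_sup (ubA _); exact: supA.1.
have := E_sup (Num.truncn (E (sup A))).+1.
by rewrite ltNge; apply/negP/negPn; exact: ltW (truncnS_gt _).
Qed.

End LocallyBounded.

(** * Propagation with finite out-of-band attenuation *)

Record propagation (R : realType) (W : set R) (a0 a1 b2 g M : R)
    (q Q : R -> R -> R[i]) : Prop := Propagation {
  propagation_L2 : forall z, 0 <= z -> L2 (Q z);
  propagation_FT : forall z, 0 <= z -> is_FT (q z) (Q z);
  propagation_bound : forall z t, 0 <= z -> cabs (q z t) <= M;
  propagation_cvg0 : forall w, (Re (Q z w) @[z --> 0^'+] --> Re (Q 0 w)) /\
    (Im (Q z w) @[z --> 0^'+] --> Im (Q 0 w));
  propagation_cderive : forall z w, 0 < z ->
    cderive (fun s => Q s w) z (nlse_rhs (brickwall W a0 a1) b2 g (Q z) w) }.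

Lemma Re_nlse_rhs (R : realType) (alpha : R -> R) (b2 g : R) (f : R -> R[i]) w :
  Re (nlse_rhs alpha b2 g f w) = - alpha w / 2 * Re (f w) -
    b2 / 2 * w ^+ 2 * Im (f w) - g / (4 * pi ^+ 2) * Im (nlterm f w).
Proof.
rewrite /nlse_rhs; move: (g / (4 * pi ^+ 2)) => G.
case: (f w) => x y; case: (nlterm f w) => m n /=.
by ring.
Qed.

Lemma Im_nlse_rhs (R : realType) (alpha : R -> R) (b2 g : R) (f : R -> R[i]) w :
  Im (nlse_rhs alpha b2 g f w) = - alpha w / 2 * Im (f w) +
    b2 / 2 * w ^+ 2 * Re (f w) + g / (4 * pi ^+ 2) * Re (nlterm f w).
Proof.
rewrite /nlse_rhs; move: (g / (4 * pi ^+ 2)) => G.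
case: (f w) => x y; case: (nlterm f w) => m n /=.
by ring.
Qed.

Section Propagation.
Context {R : realType}.
Notation mu := (@lebesgue_measure R).
Variables (W : set (measurableTypeR R)) (a0 a1 b2 g M : R).
Variables (q Q : R -> R -> R[i]).
Hypothesis mW : measurable W.
Hypothesis propQ : propagation W a0 a1 b2 g M q Q.
Implicit Types (S : set (measurableTypeR R)) (s t z w k : R).

Let C := convolver_const M.
Let gam := g / (4 * pi ^+ 2).

Let C0 : 0 <= C. Proof. exact: sqr_ge0. Qed.

Let LQ z : 0 <= z -> L2 (Q z). Proof. exact: (propagation_L2 propQ). Qed.

Let convolver_Q z : 0 <= z -> convolver C (Q z).
Proof.
move=> z0; apply: is_FT_convolver (LQ z0) (propagation_FT propQ z0) _ => t.
exact: (propagation_bound propQ).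
Qed.

Let LN z : 0 <= z -> L2 (nlterm (Q z)) /\
  sqnorm (nlterm (Q z)) <= C ^+ 2 * sqnorm (Q z).
Proof.
by move=> z0; rewrite expr2; exact: (L2_nlterm (LQ z0) (convolver_Q z0)).
Qed.

Definition flux_density z w : R := 2 * gam * Im (Q z w * (nlterm (Q z) w)^*).

Definition band_flux S z : R := \int[mu]_(w in S) flux_density z w.

Lemma is_derive_spectral_density z w : 0 < z ->
  is_derive z 1 (fun s => sqn (Q s w))
  (- brickwall W a0 a1 w * sqn (Q z w) + flux_density z w).
Proof.
move=> z0; have [dRe dIm] := propagation_cderive propQ w z0.
rewrite /sqn; apply: is_derive_eq.
rewrite Re_nlse_rhs Im_nlse_rhs /flux_density Im_mulc Re_conjc Im_conjc.
rewrite -/gam; move: (Re (nlterm (Q z) w)) (Im (nlterm (Q z) w)) => m n.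
by rewrite /GRing.scale/=; field.
Qed.

Lemma continuous_spectral_density z w : 0 < z ->
  {for z, continuous (fun s => sqn (Q s w))}.
Proof.
move=> z0; apply: differentiable_continuous; apply/derivable1_diffP.
by have [] := is_derive_spectral_density w z0.
Qed.

Lemma within_continuous_spectral_density s t w : 0 <= s -> s < t ->
  {within `[s, t], continuous (fun z => sqn (Q z w))}.
Proof.
move=> s0 st; apply/(continuous_within_itvP _ st); split.
- move=> z; rewrite in_itv/= => /andP[sz _].
  by apply: continuous_spectral_density; exact: le_lt_trans sz.
- move: s0; rewrite le_eqVlt => /predU1P[<-|s0]; last first.
    by apply: cvg_at_right_filter; exact: continuous_spectral_density.
  have [cRe cIm] := propagation_cvg0 propQ w.
  by rewrite /sqn; apply: cvgD; rewrite expr2; under eq_fun do rewrite expr2;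
    exact: cvgM.
- apply: cvg_at_left_filter; apply: continuous_spectral_density.
  exact: le_lt_trans st.
Qed.

Lemma flux_density_le k z w : 0 < k -> `|flux_density z w| <=
  `|gam| * (k * sqn (Q z w) + k^-1 * sqn (nlterm (Q z) w)).
Proof.
move=> k0; rewrite /flux_density -mulrA mulrCA normrM ler_wpM2l// normrM.
rewrite ger0_norm//.
rewrite -!sqr_cabs (le_trans _ (young_sqr _ _ k0))// ler_wpM2l//.
by rewrite (le_trans (normr_Im_le _))// cabsM cabsJ.
Qed.

Lemma integrable_flux_density S z : measurable S -> 0 <= z ->
  mu.-integrable S (EFin \o flux_density z).
Proof.
move=> mS z0; suff : mu.-integrable setT (EFin \o flux_density z).
  exact: integrableS.
apply: integrableZl_EFin => //.
by have [] := cintegrable_inner (LQ z0) (LN z0).1.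
Qed.

Lemma Rintegral_flux_le S k z : measurable S -> 0 < k -> 0 <= z ->
  \int[mu]_(w in S) `|flux_density z w| <=
  `|gam| * (k * sqnorm_on S (Q z) + k^-1 * (C ^+ 2 * sqnorm (Q z))).
Proof.
move=> mS k0 z0; have [LNz N_le] := LN z0.
have Qi := integrableZl_EFin k mS (L2_integrable mS (LQ z0)).
have Ni := integrableZl_EFin k^-1 mS (L2_integrable mS LNz).
have QNi := integrableD_EFin mS Qi Ni.
apply: (@le_trans _ _ (\int[mu]_(w in S)
    (`|gam| * (k * sqn (Q z w) + k^-1 * sqn (nlterm (Q z) w))))).
  apply: le_Rintegral => //.
  - exact: integrable_norm (integrable_flux_density mS z0).
  - exact: integrableZl_EFin.
  - by move=> w _; exact: flux_density_le.
rewrite RintegralZl// RintegralD//.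
rewrite !RintegralZl//; last exact: (L2_integrable mS (LQ z0)); last first.
  exact: (L2_integrable mS LNz).
rewrite ler_wpM2l// lerD2l ler_wpM2l ?invr_ge0 ?(ltW k0)// (le_trans _ N_le)//.
exact: sqnorm_on_le.
Qed.

Lemma band_flux_setC S z : measurable S -> 0 <= z ->
  band_flux (~` S) z = - band_flux S z.
Proof.
move=> mS z0; have fluxi := integrable_flux_density measurableT z0.
apply/eqP; rewrite -addr_eq0 addrC -(Rintegral_setC mS fluxi) /flux_density.
have [_ innerIm_i] := cintegrable_inner (LQ z0) (LN z0).1.
rewrite RintegralZl//; apply/eqP; rewrite [X in _ * X](_ : _ =
  Im (inner (Q z) (nlterm (Q z))))//.
by rewrite (Im_inner_nlterm (LQ z0) (convolver_Q z0)) mulr0.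
Qed.

Lemma band_balance S (alpha lambda s t E0 : R) : measurable S ->
  (forall w, S w -> brickwall W a0 a1 w = alpha) -> 0 <= s -> s < t ->
  (forall z, s <= z <= t -> sqnorm (Q z) <= E0) ->
  let d z := expR (lambda * z) *
    ((lambda - alpha) * sqnorm_on S (Q z) + band_flux S z) in
  mu.-integrable `]s, t[ (EFin \o d) /\
  \int[mu]_(z in `]s, t[) d z =
    expR (lambda * t) * sqnorm_on S (Q t) -
    expR (lambda * s) * sqnorm_on S (Q s).
Proof.
move=> mS alphaS s0 st Q_le; have s_in : s <= s <= t by rewrite lexx ltW.
have E00 : 0 <= E0 by apply: le_trans (Q_le s s_in); exact: sqnorm_on_ge0.
have z_ge0 z : s <= z <= t -> 0 <= z by move=> /andP[sz _]; exact: le_trans sz.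
have z_gt0 z : s < z < t -> 0 < z by move=> /andP[sz _]; exact: le_lt_trans sz.
have itv_ooW z : s < z < t -> s <= z <= t by case/andP => ? ?; rewrite !ltW.
have CE0 : 0 <= C * E0 ^+ 2 by rewrite mulr_ge0 ?sqr_ge0.
apply: (@energy_balance _ (fun z w => sqn (Q z w)) flux_density S s t
  alpha lambda (`|gam| * (1 + C * E0 ^+ 2)) E0
  (`|gam| * (1 * E0 + 1^-1 * (C ^+ 2 * E0)))) => //.
- by rewrite mulr_ge0// addr_ge0.
- by move=> z w; exact: sqn_ge0.
- by move=> w _; exact: within_continuous_spectral_density.
- by move=> z w /z_gt0 z0 /alphaS <-; exact: is_derive_spectral_density.
- move=> z w hz _; have z0 := ltW (z_gt0 z hz).
  apply: (le_trans (flux_density_le z w ltr01)); rewrite invr1 !mul1r -mulrA.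
  rewrite ler_wpM2l//; have P0 := sqn_ge0 (Q z w).
  have := sqn_nlterm_le (LQ z0) (convolver_Q z0) w.
  have : C * sqnorm (Q z) ^+ 2 <= C * E0 ^+ 2.
    rewrite ler_wpM2l// ler_sqr ?nnegrE ?sqnorm_on_ge0//; exact/Q_le/itv_ooW.
  by nra.
- by move=> z /z_ge0 z0; exact: L2_integrable (LQ z0).
- by move=> z /z_gt0/ltW; exact: integrable_flux_density.
- move=> z hz; apply: le_trans (Q_le z hz).
  by apply: sqnorm_on_le => //; exact/LQ/z_ge0.
- move=> z hz; have z0 := ltW (z_gt0 z hz); have Qz := Q_le z (itv_ooW z hz).
  apply: le_trans (Rintegral_flux_le mS ltr01 z0) _; rewrite ler_wpM2l// lerD//.
    by rewrite ler_wpM2l// (le_trans _ Qz)// sqnorm_on_le//; exact: LQ.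
  by rewrite ler_wpM2l ?invr1// ler_wpM2l ?sqr_ge0.
Qed.

Let brickwall_in w : W w -> brickwall W a0 a1 w = a0.
Proof. by move=> Ww; rewrite /brickwall asboolT. Qed.

Let brickwall_out w : (~` W) w -> brickwall W a0 a1 w = a1.
Proof. by move=> Ww; rewrite /brickwall asboolF. Qed.

Let mWC : measurable (~` W). Proof. exact: measurableC. Qed.

Lemma total_balance (lambda s t : R) : 0 <= s -> s < t ->
  bounded_on (fun z => sqnorm (Q z)) s t ->
  let d z := expR (lambda * z) * ((lambda - a0) * sqnorm_on W (Q z) +
    (lambda - a1) * sqnorm_on (~` W) (Q z)) in
  mu.-integrable `]s, t[ (EFin \o d) /\
  \int[mu]_(z in `]s, t[) d z =
    expR (lambda * t) * sqnorm (Q t) - expR (lambda * s) * sqnorm (Q s).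
Proof.
move=> s0 st [E0 E0_le] d; have t0 : 0 <= t by exact: ltW (le_lt_trans s0 st).
have [i1 e1] := band_balance lambda mW brickwall_in s0 st E0_le.
have [i2 e2] := band_balance lambda mWC brickwall_out s0 st E0_le.
set d1 := fun z => _ in i1 e1; set d2 := fun z => _ in i2 e2.
have dE z : `]s, t[%classic z -> d1 z + d2 z = d z.
  rewrite /= in_itv/= => /andP[sz _]; rewrite /d1 /d2 /d.
  by rewrite (band_flux_setC mW (ltW (le_lt_trans s0 sz))); ring.
split.
  apply: eq_integrable (integrableD_EFin _ i1 i2) => // z /set_mem zst /=.
  by rewrite dE.
transitivity (\int[mu]_(z in `]s, t[) (d1 z + d2 z)).
  by apply: eq_Rintegral => z /set_mem zst; rewrite dE.
rewrite RintegralD// e1 e2 (sqnorm_setC mW (LQ t0)) (sqnorm_setC mW (LQ s0)).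
by ring.
Qed.

Lemma sqnorm_lsc z (m : R) : 0 < z -> m < sqnorm (Q z) ->
  exists2 e, 0 < e & forall s, z - e <= s <= z -> 0 <= s -> m < sqnorm (Q s).
Proof.
move=> z0 m_lt; apply: contrapT => not_lsc.
have s_exists (n : nat) : exists s,
    [/\ z - n.+1%:R^-1 <= s <= z, 0 <= s & sqnorm (Q s) <= m].
  apply: contrapT => no_s; apply: not_lsc; exists n.+1%:R^-1 => // s hs s0.
  by rewrite ltNge; apply/negP => Qs; apply: no_s; exists s.
have [s_ s_P] := choice s_exists.
have s_z : s_ n @[n --> \oo] --> z.
  apply: (@squeeze_cvgr _ _ _ _ (fun n => z - n.+1%:R^-1) (fun=> z)).
  - by apply: nearW => n; have [] := s_P n.
  - have : z - n.+1%:R^-1 @[n --> \oo] --> z - 0.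
      by apply: cvgB; [exact: cvg_cst|exact: cvg_harmonic].
    by rewrite subr0.
  - exact: cvg_cst.
have [] := @fatou_Rintegral _ _ _ mu setT
  (fun n => sqn \o Q (s_ n)) (sqn \o Q z) m.
- exact: measurableT.
- by move=> n; have [_ s0 _] := s_P n; exact: L2_integrable (LQ s0).
- by move=> n w; exact: sqn_ge0.
- move=> w _; apply: (cvg_comp s_ (fun s => sqn (Q s w)) s_z).
  exact: continuous_spectral_density.
- by move=> n; have [_ _] := s_P n.
- by move=> _; rewrite leNgt m_lt.
Qed.

Hypotheses (a0_ge0 : 0 <= a0) (a0_le : a0 <= a1).

Lemma sqnorm_nonincreasing s t : 0 <= s -> s < t ->
  bounded_on (fun z => sqnorm (Q z)) s t -> sqnorm (Q t) <= sqnorm (Q s).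
Proof.
move=> s0 st Qb; have [i e] := total_balance 0 s0 st Qb.
move: e; rewrite !mul0r expR0 !mul1r => e; rewrite -subr_le0 -e.
apply: (@le_trans _ _ (\int[mu]_(z in `]s, t[) (0 : R))); last first.
  by rewrite Rintegral_cst// mul0r.
apply: le_Rintegral => //.
  by apply: continuous_integrable_itvoo => x; exact: cvg_cst.
move=> z _; rewrite mul0r expR0 mul1r !sub0r !mulNr -opprD oppr_le0.
by rewrite addr_ge0// mulr_ge0 ?sqnorm_on_ge0// (le_trans a0_ge0).
Qed.

Lemma sqnorm_growth s t : 0 <= s -> s < t ->
  bounded_on (fun z => sqnorm (Q z)) s t ->
  sqnorm (Q s) <= expR (a1 * (t - s)) * sqnorm (Q t).
Proof.
move=> s0 st Qb; have [i e] := total_balance a1 s0 st Qb.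
have increasing : expR (a1 * s) * sqnorm (Q s) <= expR (a1 * t) * sqnorm (Q t).
  rewrite -subr_ge0 -e; apply: Rintegral_ge0 => z _.
  by rewrite subrr mul0r addr0 !mulr_ge0 ?expR_ge0 ?subr_ge0 ?sqnorm_on_ge0.
rewrite mulrBr expRD mulrAC expRN ler_pdivlMr ?expR_gt0//.
by rewrite mulrC.
Qed.

Lemma sqnorm_le_initial t : 0 <= t -> sqnorm (Q t) <= sqnorm (Q 0).
Proof.
rewrite le_eqVlt => /predU1P[<-//|t0]; apply: sqnorm_nonincreasing => //.
apply: (@locally_bounded _ (fun z => sqnorm (Q z)) a1) => //.
- exact: le_trans a0_le.
- by move=> z; exact: sqnorm_on_ge0.
- exact: sqnorm_lsc.
- exact: sqnorm_nonincreasing.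
- exact: sqnorm_growth.
- exact: ltW.
Qed.

Definition flux_const (T0 : R) : R := `|gam| * (1 + C ^+ 2) * T0.

Let F := flux_const (sqnorm (Q 0)).

Let F0 : 0 <= F.
Proof.
by rewrite /F /flux_const !mulr_ge0 ?sqnorm_on_ge0// addr_ge0 ?sqr_ge0.
Qed.

Lemma band_flux_le S z : measurable S -> 0 <= z -> `|band_flux S z| <= F.
Proof.
move=> mS z0; have Qz := sqnorm_le_initial z0.
apply: (le_trans (le_normr_Rintegral mS (integrable_flux_density mS z0))).
apply: le_trans (Rintegral_flux_le mS ltr01 z0) _.
rewrite /F /flux_const -[leRHS]mulrA ler_wpM2l// invr1 !mul1r mulrDl mul1r.
rewrite lerD//.
  by rewrite (le_trans _ Qz)// sqnorm_on_le//; exact: LQ.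
by rewrite ler_wpM2l ?sqr_ge0.
Qed.

Let initial_bound t z : 0 <= z <= t -> sqnorm (Q z) <= sqnorm (Q 0).
Proof. by move=> /andP[z0 _]; exact: sqnorm_le_initial. Qed.

Lemma out_of_band_le t : 0 < a1 -> 0 < t -> sqnorm_on (~` W) (Q t) <=
  expR (- a1 * t) * sqnorm (Q 0) + F / a1.
Proof.
move=> a1_gt0 t0.
have [i e] := band_balance a1 mWC brickwall_out (lexx 0) t0 (@initial_bound t).
have expi := continuous_integrable_itvoo 0 t (@continuous_expRM _ a1).
have growth_le :
    expR (a1 * t) * sqnorm_on (~` W) (Q t) - sqnorm_on (~` W) (Q 0) <=
    F * ((expR (a1 * t) - 1) / a1).
  move: e; rewrite mulr0 expR0 mul1r => <-.
  rewrite -Rintegral_itvoo_expRM ?gt_eqF ?(ltW t0)// -RintegralZl//.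
  apply: le_Rintegral => //; first exact: integrableZl_EFin.
  move=> z; rewrite /= in_itv/= => /andP[z0 _].
  rewrite subrr mul0r add0r mulrC ler_wpM2r ?expR_ge0//.
  exact: le_trans (ler_norm _) (band_flux_le mWC (ltW z0)).
have e0 : 0 < expR (a1 * t) by exact: expR_gt0.
rewrite -(ler_pM2l e0) mulrDr mulrA -expRD mulNr subrr expR0 mul1r.
have out0 := sqnorm_on_le mWC (LQ (lexx 0)).
have Fa : 0 <= F / a1 by rewrite divr_ge0// ltW.
move: growth_le; rewrite (_ : F * ((expR (a1 * t) - 1) / a1) =
  expR (a1 * t) * (F / a1) - F / a1); last by ring.
by lra.
Qed.

Lemma in_band_flux_le k z : 0 < a1 -> 0 < k -> 0 < z -> `|band_flux W z| <=
  `|gam| * (k * (expR (- a1 * z) * sqnorm (Q 0) + F / a1) +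
            k^-1 * (C ^+ 2 * sqnorm (Q 0))).
Proof.
move=> a1_gt0 k0 z0; have z_ge0 := ltW z0.
rewrite -normrN -band_flux_setC//.
apply: (le_trans (le_normr_Rintegral mWC (integrable_flux_density mWC z_ge0))).
apply: le_trans (Rintegral_flux_le mWC k0 z_ge0) _; rewrite ler_wpM2l// lerD//.
  by rewrite ler_wpM2l ?(ltW k0)// out_of_band_le.
rewrite ler_wpM2l ?invr_ge0 ?(ltW k0)// ler_wpM2l ?sqr_ge0//.
exact: sqnorm_le_initial.
Qed.

Definition in_band_const (T0 t : R) : R :=
  `|gam| * (T0 + flux_const T0 * t + C ^+ 2 * T0 * t).

(* The choice [k = sqrt a1] balances the two terms of [in_band_flux_le]. *)
Lemma in_band_le t : 0 < a1 -> 0 < t ->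
  `|expR (a0 * t) * sqnorm_on W (Q t) - sqnorm_on W (Q 0)| <=
  expR (a0 * t) * in_band_const (sqnorm (Q 0)) t / Num.sqrt a1.
Proof.
move=> a1_gt0 t0; set T0 := sqnorm (Q 0); pose k := Num.sqrt a1.
have k0 : 0 < k by rewrite sqrtr_gt0.
have a1E : a1 = k ^+ 2 by rewrite sqr_sqrtr// ltW.
have [i e] := band_balance a0 mW brickwall_in (lexx 0) t0 (@initial_bound t).
move: e; rewrite mulr0 expR0 mul1r => <-.
pose A := `|gam| * (k * T0).
pose B := `|gam| * (k * (F / a1) + k^-1 * (C ^+ 2 * T0)).
have A0 : 0 <= A by rewrite !mulr_ge0 ?(ltW k0) ?sqnorm_on_ge0.
have [ABi AB_le] := Rintegral_itvoo_expRN_affine_le B a1_gt0 t0 A0.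
apply: (le_trans (le_normr_Rintegral _ i)) => //.
apply: (@le_trans _ _ (\int[mu]_(z in `]0, t[)
    (expR (a0 * t) * (A * expR (- a1 * z) + B)))).
  apply: le_Rintegral => //; [exact: integrable_norm|exact: integrableZl_EFin|].
  move=> z; rewrite /= in_itv/= => /andP[z0 zt].
  rewrite subrr mul0r add0r normrM ger0_norm ?expR_ge0//.
  apply: ler_pM; rewrite ?expR_ge0 ?ler_expR ?ler_wpM2l ?(ltW zt)//.
  apply: (le_trans (in_band_flux_le a1_gt0 k0 z0)); rewrite -/T0.
  by rewrite /A /B le_eqVlt -subr_eq0; apply/orP; left; apply/eqP; ring.
rewrite RintegralZl// -mulrA ler_wpM2l ?expR_ge0// (le_trans AB_le)//.
rewrite le_eqVlt; apply/orP; left; apply/eqP.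
by rewrite /in_band_const /A /B -/F -/k a1E; field; rewrite gt_eqF.
Qed.

End Propagation.

(** * Infinite out-of-band attenuation *)

Section PositiveInfinity.
Context {R : realType}.

Lemma cvg_divry0 {I : Type} {F : set_system I} {FF : Filter F}
    (f : I -> R) (k : R) :
  f x @[x --> F] --> +oo -> k / f x @[x --> F] --> 0.
Proof.
move=> fy; rewrite -(mulr0 k); apply: cvgM; first exact: cvg_cst.
by apply/gtr0_cvgV0 => //; exact: (cvgry_gt fy).
Qed.

Lemma cvgr_sqrt : Num.sqrt (x : R) @[x --> +oo] --> +oo.
Proof.
apply/cvgryPge => B; near=> x.
by rewrite (le_trans (ler_norm B))// -sqrtr_sqr ler_sqrt.
Unshelve. all: by end_near. Qed.

Lemma cvgr_expRN_mul (t : R) : 0 < t -> expR (- x * t) @[x --> +oo] --> 0.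
Proof.
move=> t0; have xty : x * t @[x --> +oo] --> +oo.
  by apply/cvgryPge => B; near=> x; rewrite -ler_pdivrMr.
under eq_fun do rewrite mulNr.
exact: (cvg_comp (fun x => x * t) (fun y => expR (- y)) xty (@cvgr_expR R)).
Unshelve. all: by end_near. Qed.

End PositiveInfinity.

Section BrickWallLimit.
Context {R : realType}.
Notation mu := (@lebesgue_measure R).
Variables (W : set (measurableTypeR R)) (a0 b2 g A M : R).
Variables (q_ Q_ : R -> R -> R -> R[i]) (Q0 : R -> R[i]).
Hypotheses (mW : measurable W) (a0_ge0 : 0 <= a0).
Hypothesis Q_init : forall a, A <= a -> Q_ a 0 = Q0.
Hypothesis propQ : forall a, A <= a -> propagation W a0 a b2 g M (q_ a) (Q_ a).

Lemma out_of_band_cvg0 (z : R) : 0 < z ->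
  sqnorm_on (~` W) (Q_ a z) @[a --> +oo] --> 0.
Proof.
move=> z0; apply: (@squeeze_cvgr _ _ _ _ (fun=> 0) (fun a : R =>
  expR (- a * z) * sqnorm Q0 + flux_const g M (sqnorm Q0) / a)).
- near=> a; rewrite sqnorm_on_ge0/=.
  have Aa : A <= a by [].
  by rewrite -(Q_init Aa); exact: (out_of_band_le mW (propQ Aa)).
- exact: cvg_cst.
- rewrite -[X in _ --> X](addr0 0) -{1}(mul0r (sqnorm Q0)); apply: cvgD.
    by apply: cvgM; [exact: cvgr_expRN_mul|exact: cvg_cst].
  exact: (cvg_divry0 (f := idfun)).
Unshelve. all: by end_near. Qed.

Lemma in_band_cvg (z : R) : 0 < z ->
  sqnorm_on W (Q_ a z) @[a --> +oo] --> expR (- a0 * z) * sqnorm_on W Q0.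
Proof.
move=> z0; have e0 : expR (a0 * z) != 0 by rewrite gt_eqF ?expR_gt0.
have eQ_cvg :
    expR (a0 * z) * sqnorm_on W (Q_ a z) @[a --> +oo] --> sqnorm_on W Q0.
  apply/subr_cvg0; apply: norm_cvg0.
  apply: (@squeeze_cvgr _ _ _ _ (fun=> 0) (fun a : R =>
    expR (a0 * z) * in_band_const g M (sqnorm Q0) z / Num.sqrt a)).
  - near=> a; rewrite normr_ge0/=.
    have Aa : A <= a by [].
    by rewrite -(Q_init Aa); exact: (in_band_le mW (propQ Aa)).
  - exact: cvg_cst.
  - exact: cvg_divry0 cvgr_sqrt.
rewrite (_ : (fun a : R => _) = fun a : R =>
    expR (- a0 * z) * (expR (a0 * z) * sqnorm_on W (Q_ a z))).
  by apply: cvgM eQ_cvg; exact: cvg_cst.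
by apply/funext => a; rewrite mulrA -expRD mulNr addNr expR0 mul1r.
Unshelve. all: by end_near. Qed.

Variables (z : R) (Qz : R -> R[i]).
Hypotheses (z0 : 0 < z) (LQz : L2 Qz).
Hypothesis Q_cvg : L2dist2 (Q_ a z) Qz @[a --> +oo] --> 0%E.

Let sqnorm_on_lim S : measurable S ->
  sqnorm_on S (Q_ a z) @[a --> +oo] --> sqnorm_on S Qz.
Proof.
move=> mS; apply: sqnorm_on_cvg => //; last exact: fine_cvg Q_cvg.
near=> a; have Aa : A <= a by [].
exact: propagation_L2 (propQ Aa) _ (ltW z0).
Unshelve. all: by end_near. Qed.

Lemma brickwall_limit_out_of_band : sqnorm_on (~` W) Qz = 0.
Proof.
exact: cvg_unique (sqnorm_on_lim (measurableC mW)) (out_of_band_cvg0 z0).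
Qed.

Lemma brickwall_limit_sqnorm : sqnorm Qz = expR (- a0 * z) * sqnorm_on W Q0.
Proof.
rewrite (sqnorm_setC mW LQz) brickwall_limit_out_of_band addr0.
exact: cvg_unique (sqnorm_on_lim mW) (in_band_cvg z0).
Qed.

End BrickWallLimit.

Lemma measurable_window (R : realType) N (wbar Wd : 'I_N -> R) :
  measurable (window wbar Wd : set (measurableTypeR R)).
Proof.
apply: fin_bigcup_measurable => [|n _]; first exact: finite_finset.
rewrite (_ : mkset _ = `[wbar n - Wd n / 2, wbar n + Wd n / 2]%classic).
  exact: measurable_itv.
by apply/seteqP; split => w /=; rewrite in_itv/= ler_distl.
Qed.

Lemma energyE (R : realType) (f : R -> R[i]) (S : set (measurableTypeR R)) :
  measurable S -> L2 f -> energy f S = ((2 * pi)^-1 * sqnorm_on S f)%:E.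
Proof.
by move=> mS Lf; rewrite /energy EFinM -EFin_Rintegral//; exact: L2_integrable.
Qed.

Theorem theorem1 (R : realType) (N : nat) (wbar Wd : 'I_N -> R)
    (a0 b2 g A qmax : R)
    (Qa qa : R -> R -> R -> R[i]) (Q : R -> R -> R[i]) :
  (forall n m : 'I_N, n != m ->
     [set w | `|w - wbar n| <= Wd n / 2] `&` [set w | `|w - wbar m| <= Wd m / 2]
     = set0) ->
  0 <= a0 ->
  (* common initial condition *)
  (forall a1, A <= a1 -> Qa a1 0 = Q 0) ->
  (* L^2 spectra, Fourier transforms of signals bounded by qmax *)
  (forall a1 z, A <= a1 -> 0 <= z -> L2 (Qa a1 z)) ->
  (forall a1 z, A <= a1 -> 0 <= z -> is_FT (qa a1 z) (Qa a1 z)) ->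
  (forall a1 z t, A <= a1 -> 0 <= z -> cabs (qa a1 z t) <= qmax) ->
  (* propagation equation with alpha = a0 on W, a1 off W *)
  (* right-continuity at z = 0 (differentiability below covers z > 0) *)
  (forall a1 w, A <= a1 ->
     (complex.Re (Qa a1 z w) @[z --> (0:R)^'+] --> complex.Re (Qa a1 0 w)) /\
     (complex.Im (Qa a1 z w) @[z --> (0:R)^'+] --> complex.Im (Qa a1 0 w))) ->
  (forall a1 z w, A <= a1 -> 0 < z -> nl_defined (Qa a1 z) w) ->
  (forall a1 z w, A <= a1 -> 0 < z ->
     cderive (fun s => Qa a1 s w) z
       (nlse_rhs (brickwall (window wbar Wd) a0 a1) b2 g (Qa a1 z) w)) ->
  (* brick-wall propagation = limit a1 -> +oo (in L^2, for each z > 0) *)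
  (forall z : R, 0 < z -> L2 (Q z) /\
     (L2dist2 (Qa a1 z) (Q z) @[a1 --> +oo%R] --> 0%E)) ->
  forall z : R, 0 < z ->
    energy (Q z) (~` window wbar Wd) = 0%E /\
    energy (Q z) setT = (energy (Q 0%R) (window wbar Wd) * (expR (- a0 * z)%R)%:E)%E.
Proof.
move=> _ a0_ge0 init LQa FTa boundQa cvg0a _ deriva lim z z0.
have mW := measurable_window wbar Wd; have [LQz Q_cvg] := lim z z0.
have LQ0 : L2 (Q 0) by rewrite -(init A)//; exact: LQa.
have propQa a1 : A <= a1 ->
    propagation (window wbar Wd) a0 a1 b2 g qmax (qa a1) (Qa a1).
  by move=> Aa1; split=> *; [exact: LQa|exact: FTa|exact: boundQa|
    exact: cvg0a|exact: deriva].
rewrite !energyE//; last exact: measurableC.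
rewrite (brickwall_limit_out_of_band mW a0_ge0 init propQa z0 LQz Q_cvg) mulr0.
rewrite (brickwall_limit_sqnorm mW a0_ge0 init propQa z0 LQz Q_cvg).
by split=> //; rewrite -EFinM mulrCA mulrC.
Qed.
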